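(* Let $q\ge 7$ be an odd prime power, $\Sigma_\infty$ a hyperplane of $\mathrm{PG}(4,q)$, and let $\mathcal C$ be a set of $q^2$ affine points together with a set of affine planes ($\mathcal C$-planes) satisfying: (A1) each $\mathcal C$-plane meets $\mathcal C$ in a $q$-arc, and every plane meeting $\mathcal C$ in more than four points is a $\mathcal C$-plane; (A2) any two distinct points of $\mathcal C$ lie in exactly one $\mathcal C$-plane; (A3) each affine point is either in $\mathcal C$, or on no $\mathcal C$-plane, or on exactly two $\mathcal C$-planes. Then for every point $A\in\mathcal C$, the set $t_A$ is a line of $\Sigma_\infty$.
   Context: Affine points/lines/planes are those not contained in $\Sigma_\infty$. A $k$-arc is a set of $k$ points of a plane, no three collinear. For a $\mathcal C$-plane $\pi$, the $q$-arc $\pi\cap\mathcal C$ lies ($q$ odd) in a unique conic $(\pi\cap\mathcal C)\cup\{\pi_\infty\}$ of $\pi$. For $A\in\mathcal C$ and a $\mathcal C$-plane $\pi$ through $A$, let $A_\pi$ be the point where the tangent line at $A$ (in $\pi$) to the conic $(\pi\cap\mathcal C)\cup\{\pi_\infty\}$ meets $\Sigma_\infty$. There are exactly $q+1$ $\mathcal C$-planes $\pi_1,\dots,\pi_{q+1}$ through $A$, and $t_A=\{A_{\pi_1},\dots,A_{\pi_{q+1}}\}$. *)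

(* Defs.v *)
From HB Require Import structures.
From mathcomp Require Import all_boot all_order all_algebra.
Set Implicit Arguments.
Unset Strict Implicit.
Unset Printing Implicit Defensive.
Import GRing.Theory.

(* PG(4, q): points, lines, planes and hyperplanes are the linear subspaces of
   F^5 of dimension 1, 2, 3 and 4, where #|F| = q; incidence is inclusion. *)
Notation PG4 F := {vspace 'rV[F]_5}.

(* A subspace is determined by its reduced basis matrix, so PG4 F is a finite
   type. *)
HB.instance Definition _ (F : finFieldType) : isCountable (PG4 F) :=
  CanIsCountable (@VectorInternalTheory.vs2mxK F 'rV[F]_5).
HB.instance Definition _ (F : finFieldType) : isFinite (PG4 F) :=
  CanIsFinite (@VectorInternalTheory.vs2mxK F 'rV[F]_5).

Section PG4Geometry.

Variable F : finFieldType.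
Implicit Types (Sigma U A P X l pi : PG4 F) (K S C planes : {set PG4 F}).

Definition is_point U : bool := \dim U == 1.
Definition is_line U : bool := \dim U == 2.
Definition is_plane U : bool := \dim U == 3.
Definition is_hyperplane U : bool := \dim U == 4.

Definition affine Sigma U : bool := ~~ (U <= Sigma)%VS.

Definition points_on U : {set PG4 F} := [set P | is_point P & (P <= U)%VS].

Definition collinear S : bool :=
  [exists l : PG4 F, is_line l && (S \subset points_on l)].

Definition is_arc (k : nat) pi S : bool :=
  [&& is_plane pi, S \subset points_on pi, #|S| == k &
      [forall T : {set PG4 F}, (T \subset S) && (#|T| == 3) ==> ~~ collinear T]].

Local Open Scope ring_scope.

Implicit Types (Q : 'M[F]_5) (u v : 'rV[F]_5).

(* Every quadratic form on a subspace of F^5 is the restriction of some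
   v |-> v Q v^T. *)
Definition qform Q v : F := (v *m Q *m v^T) 0 0.
Definition polar_form Q u v : F := qform Q (u + v) - qform Q u - qform Q v.

Definition nondegenerate_on pi Q : bool :=
  [forall u : 'rV[F]_5,
    [&& u \in pi, qform Q u == 0 &
        [forall v : 'rV[F]_5, (v \in pi) ==> (polar_form Q u v == 0)]]
    ==> (u == 0)].

Definition quadric_points pi Q : {set PG4 F} :=
  [set P in points_on pi | [forall v : 'rV[F]_5, (v \in P) ==> (qform Q v == 0)]].

Definition is_conic pi K : bool :=
  is_plane pi &&
  [exists Q : 'M[F]_5, nondegenerate_on pi Q && (K == quadric_points pi Q)].

Local Close Scope ring_scope.

Definition is_tangent pi K A l : bool :=
  [&& is_line l, (l <= pi)%VS & points_on l :&: K == [set A]].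

(* X is the point completing the q-arc of pi to a conic (it is unique for odd
   q >= 7), and P is the point where the tangent to that conic at A meets Sigma. *)
Definition is_tangent_trace Sigma C A pi P : bool :=
  [exists X : PG4 F, exists l : PG4 F,
    [&& is_conic pi (X |: (points_on pi :&: C)),
        is_tangent pi (X |: (points_on pi :&: C)) A l &
        P == (l :&: Sigma)%VS]].

Definition t_set Sigma C planes A : {set PG4 F} :=
  [set P | [exists pi in planes, (A <= pi)%VS && is_tangent_trace Sigma C A pi P]].

End PG4Geometry.

(* Main.v *)
Require Import Defs.
From mathcomp Require Import all_boot all_order all_fingroup all_algebra all_solvable all_field.
From mathcomp Require Import zify ring.
Set Implicit Arguments.
Unset Strict Implicit.
Unset Printing Implicit Defensive.
Import GRing.Theory.

(* Counting the affine points of a C-plane pi outside C, each of which lies on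
   exactly one other C-plane, shows that q - 1 or q of the other C-planes meet pi
   in an affine line, and that these lines are parallel.  If they were only q - 1,
   the q C-planes of the parallel class of pi would meet each other in affine
   points, and the leftover lines of these planes would all lie in one plane,
   a C-plane by (A1), contradicting (A3).  So pi has a point at infinity, its
   axis, such that every point A of pi in C lies on exactly one further C-plane
   meeting pi in the line from A to the axis: the partner of pi at A, which has
   the same axis.

   The arc of pi together with its axis is an oval tangent to the line at
   infinity, and Segre's lemma of tangents makes it a conic.  The solid spanned
   by pi and its partner at A contains no other point of C, so it meets any other
   C-plane rho through A in the axis line or in the tangent at A.  The former is
   impossible: let sigma be the parallel of rho through another point B of pi;
   sending a point of sigma to the point of pi at which the partner of pi
   contains it would inject q - 1 points into the q - 2 points of pi other than
   A and B.  Hence the q + 1 tangents at A all lie in the intersection of two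
   such solids, which meets Sigma in a line. *)

(** * Subspaces of F^5 *)

Section Subspaces.

Variable F : finFieldType.
Implicit Types (U V W P R l Sigma : PG4 F).

Lemma pointP P : reflect (exists2 v, v != 0%R & P = <[v]>%VS) (is_point P).
Proof.
apply: (iffP idP) => [/eqP dP|[v v0 ->]]; last by rewrite /is_point dim_vline v0.
have P0 : P != 0%VS by rewrite -dimv_eq0 dP.
exists (vpick P); first by rewrite vpick0.
apply/eqP; rewrite eq_sym eqEdim dP dim_vline vpick0 P0 andbT.
by rewrite -memvE memv_pick.
Qed.

Lemma line_point v : v != 0%R -> is_point (<[v]>%VS : PG4 F).
Proof. by move=> v0; apply/pointP; exists v. Qed.

Lemma point_capN P U : is_point P -> ~~ (P <= U)%VS -> \dim (P :&: U) = 0.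
Proof.
move=> /eqP dP nPU; apply/eqP; rewrite -leqn0 leqNgt; apply/negP => cap0.
move/negP: nPU; apply; apply/capv_idPl/eqP.
by rewrite eqEdim capvSl dP.
Qed.

Lemma dim_addP P U : is_point P -> ~~ (P <= U)%VS -> \dim (P + U) = (\dim U).+1.
Proof.
move=> pP nPU; have := dimv_sum_cap P U.
by rewrite (point_capN pP nPU) (eqP pP); lia.
Qed.

Lemma point_sub_eq P R : is_point P -> is_point R -> (P <= R)%VS -> P = R.
Proof. by move=> /eqP dP /eqP dR PR; apply/eqP; rewrite eqEdim PR dP dR. Qed.

Lemma sub_eq U V : (U <= V)%VS -> \dim V <= \dim U -> U = V.
Proof. by move=> UV dVU; apply/eqP; rewrite eqEdim UV dVU. Qed.

Lemma dim_join P R : is_point P -> is_point R -> P != R -> \dim (P + R) = 2.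
Proof.
move=> pP pR PR; rewrite dim_addP ?(eqP pR) //.
by apply: contra PR => s; apply/eqP/point_sub_eq.
Qed.

Lemma line_join P R l : is_point P -> is_point R -> P != R -> \dim l <= 2 ->
  (P <= l)%VS -> (R <= l)%VS -> (P + R)%VS = l.
Proof.
by move=> pP pR PR dl Pl Rl; apply: sub_eq; rewrite ?subv_add ?Pl ?dim_join.
Qed.

Lemma dim_le5 U : \dim U <= 5.
Proof. by have := dimvS (subvf U); rewrite dimvf /dim /=. Qed.

Lemma exists_point U : 0 < \dim U -> exists2 P, is_point P & (P <= U)%VS.
Proof.
rewrite lt0n dimv_eq0 => U0; exists <[vpick U]>%VS.
  by rewrite line_point ?vpick0.
by rewrite -memvE memv_pick.
Qed.

(** The nonzero vectors of [U] are sorted by the point they span, q - 1 to each point. *)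
Lemma card_points U : #|points_on U| * #|F|.-1 = (#|F| ^ \dim U).-1.
Proof.
pose D := [set v : 'rV[F]_5 | (v \in U) && (v != 0%R)].
have cardD W : #|[set v : 'rV[F]_5 | (v \in W) && (v != 0%R)]| = (#|F| ^ \dim W).-1.
  rewrite -card_vspace (cardD1 0%R (mem W)) /= mem0v /=.
  by apply: eq_card => v; rewrite !inE andbC.
rewrite -(cardD U) -/D.
rewrite -[RHS]sum1_card (partition_big (fun v => <[v]>%VS : PG4 F) (mem (points_on U))) /=; last first.
  by move=> v; rewrite !inE => /andP[vU v0]; rewrite line_point // -memvE.
rewrite -sum_nat_const; apply: eq_bigr => P; rewrite inE => /andP[pP PU].
have := cardD P; rewrite (eqP pP) expn1 sum1_card => <-.
apply: eq_card => v; rewrite !inE /= [in RHS]unfold_in /= !inE.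
apply/idP/idP => [/andP[vP v0]|/andP[/andP[_ v0] /eqP <-]]; last by rewrite memv_line v0.
rewrite (subvP PU _ vP) v0 /=; apply/eqP/point_sub_eq => //; exact: line_point.
Qed.

(** A hyperplane and a subspace outside it span all of F^5, so the dimension formula loses exactly
    one. *)
Lemma affine_dim Sigma U : is_hyperplane Sigma -> affine Sigma U ->
  (\dim (U :&: Sigma)).+1 = \dim U.
Proof.
move=> /eqP dS aU; have := dimv_sum_cap U Sigma.
have le5 := dim_le5 (U + Sigma).
suff : 4 < \dim (U + Sigma) by lia.
rewrite ltnNge; apply/negP => le4; move/negP: aU; apply.
by rewrite (sub_eq (addvSr U Sigma)) ?addvSl // dS.
Qed.

Lemma card_affine Sigma U : is_hyperplane Sigma -> affine Sigma U ->
  #|[set P in points_on U | affine Sigma P]| = #|F| ^ (\dim U).-1.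
Proof.
move=> hS aU; have q2 : 1 < #|F| by rewrite finNzRing_gt1.
have : #|points_on U| = #|points_on (U :&: Sigma)| + #|[set P in points_on U | affine Sigma P]|.
  rewrite -(cardsID (points_on Sigma) (points_on U)); congr (_ + _); apply: eq_card => P.
    by rewrite !inE subv_cap; case: is_point.
  by rewrite !inE /affine; case: is_point => //=; rewrite andbC.
move=> /(congr1 (muln^~ #|F|.-1)); rewrite mulnDl !card_points.
rewrite -(affine_dim hS aU) /=.
have e0 : 0 < #|F| ^ \dim (U :&: Sigma) by rewrite expn_gt0 (ltnW q2).
rewrite expnS; set e := #|F| ^ _ in e0 *; set n := #|[set P in _ | _]|.
case: #|F| q2 => [//|m] m1 /=; rewrite mulSn (mulnC m) => eq.
have: e * m = n * m by lia.
by move/eqP; rewrite eqn_pmul2r // => /eqP.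
Qed.

Lemma card_points2 U : \dim U = 2 -> #|points_on U| = #|F|.+1.
Proof.
move=> dU; have := card_points U; rewrite dU.
have q2 : 1 < #|F| by rewrite finNzRing_gt1.
case: #|F| q2 => [//|m] /= m1 eq.
have: #|points_on U| * m = m.+2 * m by rewrite eq; nia.
by move/eqP; rewrite eqn_pmul2r; [move/eqP|lia].
Qed.

End Subspaces.

(** * Segre's theorem for ovals tangent to the line at infinity *)

Section PlaneOval.

Variable F : finFieldType.
Implicit Types (f : F -> F) (a b c x : F).
Local Open Scope ring_scope.

(** If 2 = 0, the additive order of 1 is 2 and divides the order of the field. *)
Lemma two_neq0 : odd #|F| -> 2%:R != 0 :> F.
Proof.
apply: contraTneq => two0; have : (#[1%R : F]%g %| #|[set: F]|)%N by rewrite order_dvdG ?inE.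
rewrite cardsT (nt_prime_order (p := 2)) ?oner_neq0 ?dvdn2 //.
Qed.

Lemma prod_sub_neq a : \prod_(x | x != a) (x - a) = \prod_(x : F | x != 0) x.
Proof.
rewrite [RHS](reindex_inj (addIr (- a))) /=.
by apply: eq_bigl => x; rewrite subr_eq0.
Qed.

Definition slope f a b := (f b - f a) / (b - a).

(** The q - 1 secants from the point over [a] have distinct slopes, so a single element of the field
    is left over: the slope of the tangent. *)
Lemma oval_missing_slope f a :
  (forall b c, a != b -> a != c -> b != c -> slope f a b != slope f a c) ->
  exists t, forall m, (m == t) = (m \notin [set slope f a b | b in [set~ a]]).
Proof.
move=> inj; have : #|~: [set slope f a b | b in [set~ a]]| == 1%N.
  rewrite cardsCs setCK card_in_imset; last first.
    move=> b c; rewrite !inE => ba ca eqs; apply/eqP; apply/negPn/negP => bc.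
    by move/eqP: eqs; apply/negP/inj; rewrite // eq_sym.
  by rewrite cardsC1; case: #|F| (finNzRing_gt1 F) => //= n _; rewrite subSnn.
by move=> /cards1P[t eqt]; exists t => m; rewrite -in_setC eqt in_set1.
Qed.

(* Segre's lemma of tangents for the triangle formed by the points over [a] and
   [b] and the point at infinity of the axis: both products run over the same
   second divided differences of [f]. *)
Lemma oval_tangents f t :
  (forall a m, (m == t a) = (m \notin [set slope f a b | b in [set~ a]])) ->
  (forall a b c, a != b -> a != c -> b != c -> slope f a b != slope f a c) ->
  forall a b, a != b -> t a + t b = 2%:R * slope f a b.
Proof.
move=> tP inj; pose W := \prod_(x : F | x != 0) x.
have W0 : W != 0 by apply/prodf_neq0.
(* The second divided difference of [f]. Its symmetry in [a] and [b] drives the proof. *)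
pose D a b x := (slope f a x - slope f a b) / (x - b).
(* The differences [slope f a x - slope f a b], completed by the factor for [t a], run over all
   nonzero elements, and so do the [x - b], completed by [a - b]. Both products equal [W]; dividing
   one by the other gives the identity. *)
have key a b : a != b -> (t a - slope f a b) * \prod_(x | (x != a) && (x != b)) D a b x = a - b.
  move=> ab; have ba : b != a by rewrite eq_sym.
  have tab : t a != slope f a b.
    have := tP a (t a); rewrite eqxx => /esym; apply: contraNneq => ->.
    by apply/imsetP; exists b; rewrite ?inE.
  have e1 : \prod_(x | (x != a) && (x != b)) (x - b) * (a - b) = W.
    rewrite /W -(prod_sub_neq b) [RHS](bigD1 a) //= [LHS]mulrC; congr (_ * _).
    by apply: eq_bigl => x; rewrite andbC.
  have e2 : (t a - slope f a b) * \prod_(x | (x != a) && (x != b)) (slope f a x - slope f a b) = W.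
    rewrite /W -(prod_sub_neq (slope f a b)) [RHS](bigD1 (t a)) //=; congr (_ * _).
    transitivity (\prod_(m in slope f a @: [set x | (x != a) && (x != b)]) (m - slope f a b)).
      rewrite big_imset /=; first by apply: eq_bigl => x; rewrite inE.
      move=> x y; rewrite !inE => /andP[xa _] /andP[ya _] eqs.
      by apply/eqP; apply/negPn/negP => xy; move/eqP: eqs; apply/negP/inj; rewrite // eq_sym.
    apply: eq_bigl => m; rewrite tP negbK.
    apply/imsetP/andP => [[x]|[mb /imsetP[x]]].
      rewrite inE => /andP[xa xb] ->; split; last by apply/imsetP; exists x; rewrite ?inE.
      by apply: inj; rewrite // eq_sym.
    rewrite !inE => xa mE; exists x => //; rewrite inE xa /=.
    by apply: contraNneq mb => xb; rewrite mE xb.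
  have e3 : \prod_(x | (x != a) && (x != b)) (slope f a x - slope f a b) =
      \prod_(x | (x != a) && (x != b)) D a b x * \prod_(x | (x != a) && (x != b)) (x - b).
    by rewrite -big_split /=; apply: eq_bigr => x /andP[_ xb]; rewrite divfK // subr_eq0.
  have P0 : \prod_(x | (x != a) && (x != b)) (x - b) != 0.
    by apply/prodf_neq0 => x /andP[_ xb]; rewrite subr_eq0.
  by apply: (mulIf P0); rewrite -mulrA -e3 e2 -e1 mulrC.
move=> a b ab; have ba : b != a by rewrite eq_sym.
have sC : slope f b a = slope f a b by rewrite /slope -opprB -[a - b]opprB invrN mulrNN.
have := key b a ba; rewrite sC.
have -> : \prod_(x | (x != b) && (x != a)) D b a x = \prod_(x | (x != a) && (x != b)) D a b x.
  apply: eq_big => x; first by rewrite andbC.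
  move=> /andP[xb xa]; rewrite /D /slope; field.
  by rewrite !subr_eq0 ?xa ?xb ?ab ?ba.
(* The identities for (a, b) and (b, a) share the product [P] and have opposite right-hand sides, so
   they add up to zero; [P] is nonzero because [a != b]. *)
have := key a b ab; set P := \prod_(x | _) _ => k1 k2.
have : (t a + t b - 2%:R * slope f a b) * P = 0.
  transitivity ((t a - slope f a b) * P + (t b - slope f a b) * P); first by ring.
  by rewrite k1 k2; ring.
move/eqP; rewrite mulf_eq0 => /orP[|/eqP P0]; first by rewrite subr_eq0 => /eqP.
by move/eqP: k1; rewrite P0 mulr0 eq_sym subr_eq0 (negPf ab).
Qed.

Lemma slope_eq f a b c : a != b -> a != c -> (slope f a b == slope f a c) =
  ((f b - f a) * (c - a) == (f c - f a) * (b - a)).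
Proof.
move=> ab ac; rewrite /slope eqr_div // subr_eq0 eq_sym //.
Qed.

(** The tangent relations between 0, 1 and b combine so that the values of [f] cancel, which makes
    [t] an affine function. The relation between 0 and x then gives [f] as a quadratic. *)
Lemma segre_parabola f : odd #|F| ->
  (forall a b c, a != b -> a != c -> b != c ->
     (f b - f a) * (c - a) != (f c - f a) * (b - a)) ->
  exists r s u, forall x, f x = r + s * x + u * x ^+ 2.
Proof.
move=> oddF arc; have two0 := two_neq0 oddF.
have inj a b c : a != b -> a != c -> b != c -> slope f a b != slope f a c.
  by move=> ab ac bc; rewrite slope_eq // arc.
have /fin_all_exists[t tP] a : exists t, forall m,
    (m == t) = (m \notin [set slope f a b | b in [set~ a]]).
  by apply: oval_missing_slope => b c; apply: inj.
have tan a b : (b - a) * (t a + t b) = 2%:R * (f b - f a).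
  have [->|ab] := eqVneq a b; first by rewrite !subrr mul0r mulr0.
  rewrite (oval_tangents tP inj ab) /slope mulrCA; congr (_ * _).
  by rewrite mulrC divfK // subr_eq0 eq_sym.
have lin b : t b = t 0 + b * (t 1 - t 0).
  have k1 := tan 0 1; have k2 := tan 0 b; have k3 := tan 1 b.
  apply/eqP; rewrite -subr_eq0; apply/eqP.
  transitivity ((b - 0) * (t 0 + t b) - (1 - 0) * (t 0 + t 1) - (b - 1) * (t 1 + t b)); first by ring.
  by rewrite k1 k2 k3; ring.
exists (f 0), (t 0), ((t 1 - t 0) / 2%:R) => x; have := tan 0 x.
rewrite (lin x) => k; apply: (mulfI two0).
transitivity (2%:R * f 0 + 2%:R * (f x - f 0)); first by ring.
by rewrite -k; field.
Qed.
End PlaneOval.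

(** * Conics in frame coordinates *)

Section Frames.

Variables (F : finFieldType) (Sigma pi : PG4 F).
Implicit Types (u v : 'rV[F]_5) (a b c x y : F) (P : PG4 F) (Q : 'M[F]_5).
Local Open Scope ring_scope.

(** Affine coordinates on [pi]: [e1] and [e2] span its line at infinity, and the affine points are
    the spans of [e0 + x *: e1 + y *: e2]. *)
Definition is_frame (e0 e1 e2 : 'rV[F]_5) :=
  [/\ e0 \notin Sigma, e1 \in Sigma, e2 \in Sigma, pi = (<[e0]> + (<[e1]> + <[e2]>))%VS
    & \dim pi = 3%N].

Lemma frame_mem e0 e1 e2 v : is_frame e0 e1 e2 -> v \in pi ->
  exists a b c, v = a *: e0 + b *: e1 + c *: e2.
Proof.
move=> [_ _ _ -> _] /memv_addP[_ /vlineP[a ->] [_ /memv_addP[_ /vlineP[b ->] [_ /vlineP[c ->] ->]] ->]].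
by exists a, b, c; rewrite addrA.
Qed.

Lemma mem_frame e0 e1 e2 a b c : is_frame e0 e1 e2 -> a *: e0 + b *: e1 + c *: e2 \in pi.
Proof.
move=> [_ _ _ -> _]; rewrite -addrA.
by do 2?apply: memv_add; rewrite memvZ ?memv_line.
Qed.

Definition coef (g : 'cV[F]_5) v : F := (v *m g) 0 0.

Lemma coefD g u v : coef g (u + v) = coef g u + coef g v.
Proof. by rewrite /coef mulmxDl mxE. Qed.

Lemma coefZ g a v : coef g (a *: v) = a * coef g v.
Proof. by rewrite /coef -scalemxAl mxE. Qed.

(** The coordinates are extended to linear forms on all of F^5, given by columns, because quadratic
    forms are encoded by 5 x 5 matrices, which are built from products of such columns. *)
Lemma frame_coefs e0 e1 e2 : is_frame e0 e1 e2 ->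
  exists g0 g1 g2, forall a b c, let v := a *: e0 + b *: e1 + c *: e2 in
    [/\ coef g0 v = a, coef g1 v = b & coef g2 v = c].
Proof.
move=> [_ _ _ piE dpi]; pose X := [tuple e0; e1; e2].
have freeX : free X.
  by rewrite /free /= !span_cons span_nil addv0 -piE dpi.
pose g i : 'cV[F]_5 := \col_j coord X i (delta_mx 0 j).
have gE i v : coef (g i) v = coord X i v.
  rewrite /coef mxE [in RHS](row_sum_delta v) linear_sum.
  by apply: eq_bigr => j _; rewrite mxE linearZ.
pose i0 : 'I_3 := Ordinal (isT : (0 < 3)%N); pose i1 : 'I_3 := Ordinal (isT : (1 < 3)%N).
pose i2 : 'I_3 := Ordinal (isT : (2 < 3)%N).
have cE i : [/\ coef (g i) e0 = (i0 == i)%:R, coef (g i) e1 = (i1 == i)%:R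
    & coef (g i) e2 = (i2 == i)%:R].
  by rewrite !gE -!(coord_free _ i freeX).
exists (g i0), (g i1), (g i2) => a b c v; rewrite /v !coefD !coefZ.
have [-> -> ->] := cE i0; have [-> -> ->] := cE i1; have [-> -> ->] := cE i2.
by rewrite /= !mulr0 !mulr1 !addr0 !add0r.
Qed.

Lemma frame_plane e0 e1 e2 : is_frame e0 e1 e2 -> is_plane pi.
Proof. by move=> [_ _ _ _ /eqP]. Qed.

Lemma frame_eq0 e0 e1 e2 a b c : is_frame e0 e1 e2 ->
  a *: e0 + b *: e1 + c *: e2 = 0 -> [/\ a = 0, b = 0 & c = 0].
Proof.
move=> /frame_coefs[g0 [g1 [g2 gE]]] v0; have [ea eb ec] := gE a b c.
by split; [rewrite -ea | rewrite -eb | rewrite -ec]; rewrite v0 /coef mul0mx mxE.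
Qed.

Lemma frame_neq0 e0 e1 e2 : is_frame e0 e1 e2 -> [/\ e0 != 0, e1 != 0 & e2 != 0].
Proof.
move=> fr; split; apply/eqP => z.
- have := frame_eq0 (a := 1) (b := 0) (c := 0) fr; rewrite z scaler0 !scale0r !addr0.
  by case=> // /eqP; rewrite oner_eq0.
- have := frame_eq0 (a := 0) (b := 1) (c := 0) fr; rewrite z scaler0 !scale0r !addr0.
  by case=> // _ /eqP; rewrite oner_eq0.
- have := frame_eq0 (a := 0) (b := 0) (c := 1) fr; rewrite z scaler0 !scale0r !addr0.
  by case=> // _ _ /eqP; rewrite oner_eq0.
Qed.

Lemma frame_inj e0 e1 e2 a b c a' b' c' : is_frame e0 e1 e2 ->
  a *: e0 + b *: e1 + c *: e2 = a' *: e0 + b' *: e1 + c' *: e2 -> [/\ a = a', b = b' & c = c'].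
Proof.
move=> /frame_coefs[g0 [g1 [g2 gE]]] eqv.
have [ea eb ec] := gE a b c; have [ea' eb' ec'] := gE a' b' c'.
by split; [rewrite -ea -ea' | rewrite -eb -eb' | rewrite -ec -ec']; rewrite eqv.
Qed.

Lemma affine_frame_point e0 e1 e2 P : is_frame e0 e1 e2 -> is_point P -> affine Sigma P ->
  (P <= pi)%VS -> exists x y, P = <[e0 + x *: e1 + y *: e2]>%VS.
Proof.
move=> fr pP aP Pp; have [v v0 PE] := pointP P pP.
have vp : v \in pi by rewrite memvE -PE.
have [a [b [c vE]]] := frame_mem fr vp.
have [_ S1 S2 _ _] := fr.
have a0 : a != 0.
  apply: contraNneq aP => az; rewrite PE -memvE vE az scale0r add0r.
  by rewrite memvD ?memvZ.
exists (b / a), (c / a); rewrite PE vE.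
have -> : a *: e0 + b *: e1 + c *: e2 = a *: (e0 + (b / a) *: e1 + (c / a) *: e2).
  by rewrite !scalerDr !scalerA ![a * _]mulrC !divfK.
apply/vspaceP => u; apply/vlineP/vlineP => -[k ->]; first by exists (k * a); rewrite scalerA.
by exists (k / a); rewrite scalerA divfK.
Qed.

Lemma frame_vec_neq0 e0 e1 e2 x y : is_frame e0 e1 e2 -> e0 + x *: e1 + y *: e2 != 0.
Proof.
move=> fr; apply/eqP => z; have := frame_eq0 (a := 1) (b := x) (c := y) fr.
by rewrite scale1r => /(_ z)[/eqP]; rewrite oner_eq0.
Qed.

Lemma frame_point_inj e0 e1 e2 x y x' y' : is_frame e0 e1 e2 ->
  <[e0 + x *: e1 + y *: e2]>%VS = <[e0 + x' *: e1 + y' *: e2]>%VS :> PG4 F -> x = x' /\ y = y'.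
Proof.
move=> fr eqP.
have : e0 + x *: e1 + y *: e2 \in <[e0 + x' *: e1 + y' *: e2]>%VS by rewrite -eqP memv_line.
move=> /vlineP[k]; rewrite !scalerDr !scalerA -{1}(scale1r e0) => /(frame_inj fr)[<- -> ->].
by rewrite !mul1r.
Qed.

Lemma frame_point_sub e0 e1 e2 x y : is_frame e0 e1 e2 -> (<[e0 + x *: e1 + y *: e2]> <= pi)%VS.
Proof. by move=> fr; rewrite -memvE -{1}(scale1r e0) mem_frame. Qed.

(** In the new frame the graph of r + s x + t x^2 becomes the graph of x^2. *)
Lemma frame_change e0 e1 e2 r s t : t != 0 -> is_frame e0 e1 e2 ->
  is_frame (e0 + r *: e2) (e1 + s *: e2) (t *: e2).
Proof.
move=> t0 fr; have [S0 S1 S2 piE dpi] := fr; split => //.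
- by apply: contra S0 => S0; rewrite -(addrK (r *: e2) e0) memvB ?memvZ.
- by rewrite memvD ?memvZ.
- by rewrite memvZ.
apply/eqP; rewrite eq_sym eqEsubv; apply/andP; split.
  rewrite !subv_add -!memvE; apply/and3P; split.
  - by have := mem_frame 1 0 r fr; rewrite scale1r scale0r addr0.
  - by have := mem_frame 0 1 s fr; rewrite scale1r scale0r add0r.
  - by have := mem_frame 0 0 t fr; rewrite !scale0r !add0r.
set W := (_ + _)%VS.
have W2 : e2 \in W.
  have : t *: e2 \in W by rewrite memvE; apply: subv_trans (addvSr _ _); apply: addvSr.
  by move=> /(memvZ t^-1); rewrite scalerA mulVf // scale1r.
rewrite {1}piE !subv_add -!memvE W2 andbT; apply/andP; split.
  by rewrite -(addrK (r *: e2) e0) memvB ?memvZ // memvE addvSl.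
rewrite -(addrK (s *: e2) e1) memvB ?memvZ // memvE.
by apply: subv_trans (addvSr _ _); apply: addvSl.
Qed.

Lemma qformZ Q k v : qform Q (k *: v) = k * (k * qform Q v).
Proof. by rewrite /qform linearZ -scalemxAr mxE -!scalemxAl mxE. Qed.

Definition parabola_point (e0 e1 e2 : 'rV[F]_5) x : PG4 F := <[e0 + x *: e1 + x ^+ 2 *: e2]>%VS.

(* In frame coordinates the conic is the zero set of [b ^ 2 - a c]. *)
Lemma parabola_conic e0 e1 e2 : 2%:R != 0 :> F -> is_frame e0 e1 e2 ->
  is_conic pi (<[e2]>%VS |: [set parabola_point e0 e1 e2 x | x : F]).
Proof.
move=> two0 fr; rewrite /is_conic (frame_plane fr) /=.
have [g0 [g1 [g2 gE]]] := frame_coefs fr.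
have [_ _ e2n] := frame_neq0 fr.
pose Q := g1 *m g1^T - g0 *m g2^T.
have mulE (g h : 'cV[F]_5) v : (v *m (g *m h^T) *m v^T) 0 0 = coef g v * coef h v.
  rewrite mulmxA -mulmxA mxE big_ord1 /coef; congr (_ * _).
  by rewrite -[v in LHS]trmxK -trmx_mul mxE trmxK.
have QE v : qform Q v = coef g1 v ^+ 2 - coef g0 v * coef g2 v.
  by rewrite /qform /Q mulmxBr mulmxBl mxE [in X in _ + X]mxE !mulE expr2.
have polE u v : polar_form Q u v =
    2%:R * coef g1 u * coef g1 v - coef g0 u * coef g2 v - coef g2 u * coef g0 v.
  by rewrite /polar_form !QE !coefD; ring.
apply/existsP; exists Q; apply/andP; split.
  apply/forallP => u; apply/implyP => /and3P[up _ /forallP pol].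
  have [a [b [c uE]]] := frame_mem fr up.
  have [ua ub uc] := gE a b c; rewrite -uE in ua ub uc.
  (* A vector of the radical is orthogonal to all of [pi]; testing it against the frame vectors
     kills its three coordinates. *)
  have p a' b' c' : 2%:R * b * b' - a * c' - c * a' = 0.
    have [va vb vc] := gE a' b' c'.
    have /eqP := implyP (pol _) (mem_frame a' b' c' fr).
    by rewrite polE ua ub uc va vb vc.
  have c0 : c = 0.
    by transitivity (- (2%:R * b * 0 - a * 0 - c * 1)); [ring | rewrite p oppr0].
  have a0 : a = 0.
    by transitivity (- (2%:R * b * 0 - a * 1 - c * 0)); [ring | rewrite p oppr0].
  have b0 : b = 0.
    apply: (mulfI two0); rewrite mulr0.
    by transitivity (2%:R * b * 1 - a * 0 - c * 0); [ring | rewrite p].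
  by rewrite uE a0 b0 c0 !scale0r !addr0.
apply/eqP/setP => P; rewrite in_setU1 [RHS]inE [P \in points_on _]inE.
apply/idP/idP => [/orP[/eqP ->|/imsetP[x _ ->]]|/andP[/andP[pP Pp] /forallP Qv]].
- rewrite line_point // -memvE; have := mem_frame 0 0 1 fr; rewrite !scale0r !add0r scale1r => -> /=.
  apply/forallP => v; apply/implyP => /vlineP[k ->]; have [k0 k1 k2] := gE 0 0 k.
  by move: k0 k1 k2; rewrite QE !scale0r !add0r => -> -> ->; rewrite mul0r expr0n subr0.
- rewrite line_point ?frame_vec_neq0 ?frame_point_sub //=.
  apply/forallP => v; apply/implyP => /vlineP[k ->]; rewrite !scalerDr !scalerA.
  by have [] := gE k (k * x) (k * x ^+ 2); rewrite QE => -> -> ->; apply/eqP; ring.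
have [v v0 PE] := pointP P pP.
have vp : v \in pi by rewrite memvE -PE.
have [a [b [c vE]]] := frame_mem fr vp.
have [ka kb kc] := gE a b c.
have := Qv v; rewrite {1}PE memv_line /= QE vE ka kb kc subr_eq0 => /eqP bac.
(* The conic meets the line a = 0 only in the span of [e2]. Elsewhere a scales to 1, and the
   parameter is b / a. *)
have [a0|a0] := eqVneq a 0.
  apply/orP; left; move: bac; rewrite a0 mul0r => /eqP; rewrite sqrf_eq0 => /eqP b0.
  have c0 : c != 0 by apply: contraNneq v0; rewrite vE a0 b0 => ->; rewrite !scale0r !addr0.
  apply/eqP/point_sub_eq => //; first exact: line_point.
  by rewrite PE vE a0 b0 !scale0r !add0r -memvE memvZ ?memv_line.
apply/orP; right; apply/imsetP; exists (b / a) => //.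
apply: point_sub_eq; rewrite ?line_point ?frame_vec_neq0 // PE -memvE vE.
apply/vlineP; exists a; rewrite !scalerDr !scalerA; congr (_ + _ *: _ + _ *: _).
  by rewrite mulrC divfK.
by rewrite expr_div_n bac; field.
Qed.

(* On the parabola a quadratic form is a polynomial of degree at most 4 in [x],
   whose leading coefficient is its value at [e2]. *)
Lemma qform_parabola_infinity (e0 e1 e2 : 'rV[F]_5) Q : (4 < #|F|)%N ->
  (forall x, qform Q (e0 + x *: e1 + x ^+ 2 *: e2) = 0) -> qform Q e2 = 0.
Proof.
move=> F4 Q0; pose B u v := (u *m Q *m v^T) 0 0.
have BD u v w : B (u + v) w = B u w + B v w by rewrite /B !mulmxDl mxE.
have BZ k u v : B (k *: u) v = k * B u v by rewrite /B -!scalemxAl mxE.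
have BDr u v w : B u (v + w) = B u v + B u w by rewrite /B linearD mulmxDr mxE.
have BZr k u v : B u (k *: v) = k * B u v by rewrite /B linearZ -scalemxAr mxE.
pose p : {poly F} := Poly [:: B e0 e0; B e0 e1 + B e1 e0; B e0 e2 + B e2 e0 + B e1 e1;
  B e1 e2 + B e2 e1; B e2 e2].
have px x : p.[x] = 0.
  rewrite -(Q0 x) /p horner_Poly /= /qform -/(B _ _) !(BD, BZ, BDr, BZr); ring.
(* A nonzero polynomial with five coefficients has at most four roots, while [p] vanishes on the
   whole field. *)
have p0 : p = 0.
  apply/eqP; apply: contraLR F4 => pn0; rewrite -leqNgt.
  have := max_poly_roots (rs := enum F) pn0.
  rewrite enum_uniq -cardE => /(_ _ isT) lt.
  have : (#|F| < size p)%N by apply: lt; apply/allP => x _; rewrite /root px.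
  by move=> /leq_trans /(_ (size_Poly _)).
have : p`_4 = 0 by rewrite p0 coef0.
by rewrite coef_Poly.
Qed.

End Frames.

(** * C-planes and parallelism *)

(** Arithmetic for the count of shared lines, with p = q - 1: a nonzero remainder [m] of size at
    most [p] must be exactly one multiple of [p]. *)
Lemma small_multiple_eq p q k m n : 0 < p -> m <= n -> n <= p -> m != 0 ->
  k * p + m = q * p -> [/\ m = p, n = p & k = q.-1].
Proof.
move=> p0 mn np m0 eq; have kq : k < q by rewrite -(ltn_pmul2r p0); lia.
have [d qE] : exists d, q = k + d.+1 by exists (q - k.+1); lia.
have mE : m = p + d * p by move: eq; rewrite qE mulnDl mulSn; lia.
have /eqP : d * p = 0 by lia.
by rewrite muln_eq0 => /orP[|] /eqP d0; split; lia.
Qed.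

Section CPlanes.

Variable F : finFieldType.
Local Notation q := #|F|.
Variables (Sigma : PG4 F) (C planes : {set PG4 F}).
Hypothesis q_odd : odd q.
Hypothesis q_ge7 : 7 <= q.
Hypothesis Sigma_hyp : is_hyperplane Sigma.
Hypothesis C_affine : forall P : PG4 F, P \in C -> is_point P && affine Sigma P.
Hypothesis card_C : #|C| = q ^ 2.
Hypothesis planes_affine :
  forall pi : PG4 F, pi \in planes -> is_plane pi && affine Sigma pi.
Hypothesis A1_arc :
  forall pi : PG4 F, pi \in planes -> is_arc q pi (points_on pi :&: C).
Hypothesis A1_plane : forall pi : PG4 F,
  is_plane pi -> 4 < #|points_on pi :&: C| -> pi \in planes.
Hypothesis A2 : forall P R : PG4 F, P \in C -> R \in C -> P <> R ->
  exists! pi : PG4 F, [/\ pi \in planes, (P <= pi)%VS & (R <= pi)%VS].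
Hypothesis A3 : forall P : PG4 F, is_point P -> affine Sigma P ->
  [\/ P \in C,
      forall pi : PG4 F, pi \in planes -> ~~ (P <= pi)%VS
    | #|[set pi in planes | (P <= pi)%VS]| = 2].

Implicit Types (A B D E P R Y l pi rho sigma tau : PG4 F).

Local Notation K pi := (points_on pi :&: C).
(** Meeting refers to points of [C] only, and planes that do not meet are called parallel, even if
    they share an affine point outside [C]. With the sets [K pi] as lines, [C] becomes an affine
    plane of order q. *)
Local Notation meet pi rho := (K pi :&: K rho != set0).
Local Notation affpts U := [set P in points_on U | affine Sigma P].

Lemma q_gt0 : 0 < q. Proof. exact: leq_trans q_ge7. Qed.

Lemma C_point P : P \in C -> is_point P.
Proof. by move=> /C_affine /andP[]. Qed.

Lemma C_aff P : P \in C -> affine Sigma P.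
Proof. by move=> /C_affine /andP[]. Qed.

Lemma inK P pi : (P \in K pi) = (P \in C) && (P <= pi)%VS.
Proof.
by rewrite !inE andbC; case PC: (P \in C) => //=; rewrite (C_point PC).
Qed.

Lemma plane_dim pi : pi \in planes -> \dim pi = 3.
Proof. by move=> /planes_affine /andP[/eqP]. Qed.

Lemma plane_aff pi : pi \in planes -> affine Sigma pi.
Proof. by move=> /planes_affine /andP[]. Qed.

Lemma sub_affine U V : (U <= V)%VS -> affine Sigma U -> affine Sigma V.
Proof. by move=> UV; apply: contra => /(subv_trans UV). Qed.

Lemma cardK pi : pi \in planes -> #|K pi| = q.
Proof. by move=> /A1_arc /and4P[_ _ /eqP]. Qed.

Lemma no_three pi A B D l : pi \in planes ->
  A \in K pi -> B \in K pi -> D \in K pi -> A != B -> A != D -> B != D ->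
  \dim l = 2 -> (A <= l)%VS -> (B <= l)%VS -> (D <= l)%VS -> False.
Proof.
move=> piP AK BK DK AB AD BD dl Al Bl Dl.
have /and4P[_ _ _ /forallP/(_ [set A; B; D])] := A1_arc piP.
have -> /= : [set A; B; D] \subset K pi.
  by apply/subsetP => X; rewrite !in_setU !in_set1 => /orP[/orP[]|] /eqP ->.
rewrite -setUA cardsU1 cards2 !inE BD negb_or AB AD /= => /negP; apply.
apply/existsP; exists l; rewrite /is_line dl eqxx /=.
apply/subsetP => X; rewrite !inE => /orP[|/orP[]] /eqP ->.
- by rewrite Al andbT; move: AK; rewrite inK => /andP[/C_point].
- by rewrite Bl andbT; move: BK; rewrite inK => /andP[/C_point].
- by rewrite Dl andbT; move: DK; rewrite inK => /andP[/C_point].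
Qed.

Lemma plane_uniq A B pi rho : pi \in planes -> rho \in planes ->
  A \in C -> B \in C -> A != B -> (A <= pi)%VS -> (B <= pi)%VS ->
  (A <= rho)%VS -> (B <= rho)%VS -> pi = rho.
Proof.
move=> piP rhoP CA BC /eqP AB Api Bpi Arho Brho.
have [sigma [_ uniq]] := A2 CA BC AB.
by rewrite -(uniq pi) ?(uniq rho).
Qed.

Lemma ex_plane A B : A \in C -> B \in C -> A != B ->
  exists pi, [/\ pi \in planes, (A <= pi)%VS & (B <= pi)%VS].
Proof. by move=> CA BC /eqP AB; have [pi [? _]] := A2 CA BC AB; exists pi. Qed.

Lemma meet_uniq pi rho A B : pi \in planes -> rho \in planes -> pi != rho ->
  A \in K pi -> A \in K rho -> B \in K pi -> B \in K rho -> A = B.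
Proof.
rewrite !inK => piP rhoP pirho /andP[CA Api] /andP[_ Ar] /andP[BC Bpi] /andP[_ Br].
apply/eqP; apply: contraNT pirho => AB; apply/eqP.
exact: (plane_uniq piP rhoP CA BC AB).
Qed.

(** The form in which A3 is mostly used: a third C-plane on an affine point forces it into [C]. *)
Lemma three_planes Y pi rho sigma : is_point Y -> affine Sigma Y ->
  pi \in planes -> rho \in planes -> sigma \in planes ->
  (Y <= pi)%VS -> (Y <= rho)%VS -> (Y <= sigma)%VS ->
  pi != rho -> pi != sigma -> rho != sigma -> Y \in C.
Proof.
move=> pY aY piP rP sP Ypi Yr Ys pr ps rs; case: (A3 pY aY) => //.
  by move=> /(_ _ piP); rewrite Ypi.
move=> card2; have : [set pi; rho; sigma] \subset [set pi in planes | (Y <= pi)%VS].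
  apply/subsetP => t; rewrite !inE => /orP[/orP[]|] /eqP ->; exact/andP.
move=> /subset_leq_card; rewrite card2 -setUA cardsU1 cards2 !inE negb_or.
by rewrite pr ps rs.
Qed.

Lemma other_plane Y pi : is_point Y -> affine Sigma Y -> Y \notin C ->
  pi \in planes -> (Y <= pi)%VS ->
  #|[set rho in planes | (rho != pi) && (Y <= rho)%VS]| = 1.
Proof.
move=> pY aY YC piP Ypi; case: (A3 pY aY).
- by rewrite (negPf YC).
- by move=> /(_ _ piP); rewrite Ypi.
rewrite (cardsD1 pi) inE piP Ypi /= => -[card1]; apply: etrans card1; apply: eq_card => t.
by rewrite !inE; case: (t \in planes); rewrite ?andbF.
Qed.

Definition pencil A := [set rho in planes | (A <= rho)%VS].

(** The planes through [A] partition the other q^2 - 1 points of [C] into sets of q - 1 points. *)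
Lemma card_pencil A : A \in C -> #|pencil A| = q.+1.
Proof.
move=> CA; have: #|C :\ A| = #|pencil A| * q.-1.
  transitivity (\sum_(B in C :\ A) #|[set rho in planes | (A <= rho)%VS && (B <= rho)%VS]|).
    rewrite -sum1_card; apply: eq_bigr => B; rewrite !inE => /andP[BA BC].
    apply/esym/eqP/cards1P.
    have [rho [rP Ar Br]] := ex_plane BC CA BA.
    exists rho; apply/setP => t; rewrite !inE.
    apply/idP/eqP => [/and3P[tP At Bt]|->]; last by rewrite rP Ar Br.
    exact: (plane_uniq tP rP BC CA BA).
  rewrite -sum_nat_const.
  under eq_bigr => B _ do rewrite -sum1_card.
  rewrite (exchange_big_dep (mem (pencil A))) /=; last first.
    by move=> B rho _; rewrite !inE => /and3P[-> ->].
  apply: eq_bigr => rho; rewrite inE => /andP[rP Ar].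
  rewrite sum1_card -(cardK rP) (cardsD1 A (K rho)) inK CA Ar /=.
  apply: eq_card => B; rewrite [LHS]unfold_in /= !in_setD1 inK inE rP Ar /=.
  by rewrite andbA.
move: card_C; rewrite (cardsD1 A) CA.
case: #|F| q_ge7 => [//|m] m7; rewrite add1n -mulnn => -[->] /= eq.
have: #|pencil A| * m = m.+2 * m by rewrite -eq; nia.
by move/eqP; rewrite eqn_pmul2r; [move/eqP|lia].
Qed.

(* The [q] planes joining [A] to the points of [pi] leave one plane of the pencil. *)
Lemma parallel_card A pi : pi \in planes -> A \in C -> ~~ (A <= pi)%VS ->
  #|[set rho in pencil A | ~~ meet pi rho]| = 1.
Proof.
move=> piP CA nA.
pose join B := odflt pi [pick rho in planes | (A <= rho)%VS && (B <= rho)%VS].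
have nAK B : B \in K pi -> A != B.
  by rewrite inK => /andP[_ Bpi]; apply: contra nA => /eqP ->.
have joinP B : B \in K pi -> [/\ join B \in planes, (A <= join B)%VS & (B <= join B)%VS].
  move=> BK; have AB := nAK B BK; move: BK; rewrite inK => /andP[BC Bpi].
  rewrite /join; case: pickP => [rho /and3P[]|none] //.
  have [rho [rP Ar Br]] := ex_plane CA BC AB.
  by have := none rho; rewrite rP Ar Br.
have inj : {in K pi &, injective join}.
  move=> B D BK DK eqj; have [jP Aj Bj] := joinP B BK.
  have [_ _ Dj] := joinP D DK; rewrite -eqj in Dj.
  apply: (meet_uniq piP jP _ BK _ DK).
  - by apply: contra nA => /eqP ->.
  - by move: BK; rewrite !inK Bj => /andP[->].
  - by move: DK; rewrite !inK Dj => /andP[->].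
have meetE : [set rho in pencil A | meet pi rho] = join @: K pi.
  apply/setP => rho; rewrite !inE; apply/idP/imsetP.
    move=> /andP[/andP[rP Ar] /set0Pn[B]]; rewrite in_setI => /andP[BK BKr].
    exists B => //; have [jP Aj Bj] := joinP B BK.
    move: (BK) BKr; rewrite !inK => /andP[BC _] /andP[_ Br].
    exact: (plane_uniq rP jP CA BC (nAK B BK)).
  move=> [B BK ->]; have [jP Aj Bj] := joinP B BK; rewrite jP Aj /=.
  apply/set0Pn; exists B; rewrite in_setI BK /=.
  by move: BK; rewrite !inK Bj => /andP[->].
have := cardsID [set rho | meet pi rho] (pencil A); rewrite (card_pencil CA).
rewrite -(_ : [set rho in pencil A | meet pi rho] = pencil A :&: _); last first.
  by apply/setP => t; rewrite !inE.
rewrite meetE card_in_imset // (cardK piP) => eq.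
have card1 : #|pencil A :\: [set rho | meet pi rho]| = 1.
  by apply/eqP; rewrite -(eqn_add2l q) eq addn1.
by apply: etrans card1; apply: eq_card => t; rewrite !inE andbC.
Qed.

Lemma ex_parallel A pi : pi \in planes -> A \in C -> ~~ (A <= pi)%VS ->
  exists rho, [/\ rho \in planes, (A <= rho)%VS & ~~ meet pi rho].
Proof.
move=> piP CA nA; have /eqP/cards1P[rho eqr] := parallel_card piP CA nA.
have: rho \in [set rho in pencil A | ~~ meet pi rho] by rewrite eqr set11.
by rewrite inE [rho \in pencil A]inE => /andP[/andP[]]; exists rho.
Qed.

Lemma parallel_uniq A pi rho sigma : pi \in planes -> A \in C ->
  rho \in planes -> sigma \in planes -> (A <= rho)%VS -> (A <= sigma)%VS ->
  ~~ meet pi rho -> ~~ meet pi sigma -> rho = sigma.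
Proof.
move=> piP CA rP sP Ar As npr nps.
have nA : ~~ (A <= pi)%VS.
  apply: contra npr => Api; apply/set0Pn; exists A.
  by rewrite in_setI !inK CA Api Ar.
have /eqP/cards1P[tau eqt] := parallel_card piP CA nA.
have: rho \in [set rho in pencil A | ~~ meet pi rho].
  by rewrite inE npr [rho \in pencil A]inE rP Ar.
have: sigma \in [set rho in pencil A | ~~ meet pi rho].
  by rewrite inE nps [sigma \in pencil A]inE sP As.
by rewrite eqt !inE => /eqP -> /eqP ->.
Qed.

Lemma meetC pi rho : meet pi rho = meet rho pi.
Proof. by rewrite setIC. Qed.

Lemma meetP pi rho : reflect (exists A, [/\ A \in C, (A <= pi)%VS & (A <= rho)%VS]) (meet pi rho).
Proof.
apply: (iffP (set0Pn _)) => -[A].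
  by rewrite in_setI !inK => /andP[/andP[CA Api] /andP[_ Ar]]; exists A.
by case=> CA Api Ar; exists A; rewrite in_setI !inK CA Api Ar.
Qed.

Lemma meet_self pi : pi \in planes -> meet pi pi.
Proof. by move=> piP; rewrite setIid -card_gt0 (cardK piP) q_gt0. Qed.

(** A common point of [pi] and [sigma] in [C] would have two parallels to [rho] through it. The
    planes have to be distinct since every C-plane meets itself. *)
Lemma par_trans pi rho sigma : pi \in planes -> rho \in planes -> sigma \in planes ->
  ~~ meet pi rho -> ~~ meet rho sigma -> pi != sigma -> ~~ meet pi sigma.
Proof.
move=> piP rP sP npr nrs; apply: contra => /meetP[A [CA Api As]].
by rewrite (parallel_uniq rP CA piP sP Api As) // meetC.
Qed.

Definition parallels pi := [set rho in planes | ~~ meet pi rho].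

(** Fix a second plane [rho] through a point [A] of [pi]. Every parallel of [pi] meets [rho] in a
    point other than [A], and different parallels do so in different points. *)
Lemma card_parallels pi : pi \in planes -> #|parallels pi| <= q.-1.
Proof.
move=> piP.
have /card_gt0P[A AK] : 0 < #|K pi| by rewrite (cardK piP) q_gt0.
have [CA Api] : A \in C /\ (A <= pi)%VS by move: AK; rewrite inK => /andP.
have /card_gt0P[rho] : 0 < #|pencil A :\ pi|.
  rewrite -(ltn_add2l (pi \in pencil A)) -cardsD1 (card_pencil CA).
  by rewrite addn0; rewrite ltnS; exact: leq_trans (leq_b1 _) q_gt0.
rewrite !inE => /and3P[rpi rP Ar].
have -> : q.-1 = #|K rho :\ A| by rewrite -(cardK rP) (cardsD1 A (K rho)) inK CA Ar.
pose f sigma := odflt A [pick B in K rho :&: K sigma].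
have fP sigma : sigma \in parallels pi -> f sigma \in K rho :&: K sigma.
  rewrite inE => /andP[sP ps]; rewrite /f; case: pickP => //= none.
  have nrs : ~~ meet rho sigma.
    by rewrite negbK; apply/eqP/setP => B; rewrite in_set0 none.
  have : ~~ meet pi rho by apply: (par_trans piP sP rP ps); [rewrite meetC | rewrite eq_sym].
  by move=> /negP[]; apply/meetP; exists A.
rewrite -(card_in_imset (f := f) (D := mem (parallels pi))).
  apply/subset_leq_card/subsetP => B /imsetP[sigma sp ->].
  have := fP sigma sp; rewrite inE => /andP[fr fs]; rewrite 2!inE fr andbT.
  apply: contraTneq sp => fA; rewrite inE negb_and negbK; apply/orP; right.
  by apply/meetP; exists A; split => //; move: fs; rewrite fA inK => /andP[].
move=> s1 s2 sp1 sp2 eqf; have := fP s1 sp1; have := fP s2 sp2; rewrite -eqf.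
move=> /setIP[_]; rewrite inK => /andP[fC f2] /setIP[_]; rewrite inK => /andP[_ f1].
move: sp1 sp2; rewrite !inE => /andP[s1P n1] /andP[s2P n2].
exact: (parallel_uniq piP fC s1P s2P f1 f2).
Qed.

(** * Lines shared by C-planes *)

Lemma cap_dim pi rho : pi \in planes -> rho \in planes -> pi != rho ->
  0 < \dim (pi :&: rho) <= 2.
Proof.
move=> piP rP pr; have := dimv_sum_cap pi rho; have := dim_le5 (pi + rho).
rewrite (plane_dim piP) (plane_dim rP) => le5 sum.
apply/andP; split; first by lia.
rewrite leqNgt; apply: contra pr => d3.
have e1 := sub_eq (capvSl pi rho); have e2 := sub_eq (capvSr pi rho).
by rewrite -{1}e1 ?(plane_dim piP) // e2 // (plane_dim rP).
Qed.

Definition line_nbrs pi := [set rho in planes |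
  [&& rho != pi, affine Sigma (pi :&: rho)%VS & \dim (pi :&: rho) == 2]].

Lemma affineP U : is_hyperplane Sigma -> affine Sigma U ->
  exists Y, [/\ is_point Y, affine Sigma Y & (Y <= U)%VS].
Proof.
move=> hS aU; have /card_gt0P[Y] : 0 < #|affpts U|.
  by rewrite card_affine // expn_gt0 q_gt0.
by rewrite !inE => /andP[/andP[]]; exists Y.
Qed.

Lemma in_affpts Y U : (Y \in affpts U) = [&& is_point Y, affine Sigma Y & (Y <= U)%VS].
Proof. by rewrite !inE -andbA; congr andb; rewrite andbC. Qed.

(** The intersection is a line, with q affine points if it is affine, or a single point; one point
    is lost when the planes meet in [C]. So a shared affine line counts q - 1, and parallel planes
    with a common affine point count 1 more. *)
Lemma count_cap pi rho : pi \in planes -> rho \in planes -> pi != rho ->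
  #|affpts (pi :&: rho)%VS :\: C| =
  (rho \in line_nbrs pi) * q.-1 + (~~ meet pi rho && affine Sigma (pi :&: rho)%VS).
Proof.
move=> piP rP pr; have /andP[d0 d2] := cap_dim piP rP pr.
rewrite inE rP eq_sym pr /=; case aff: (affine Sigma _); last first.
  rewrite andbF; apply/eqP; rewrite cards_eq0; apply/eqP/setP => Y.
  rewrite !inE; apply/negbTE; apply: contraFN aff => /and3P[_ /andP[_ Yc]].
  exact: sub_affine.
have cardA := card_affine Sigma_hyp aff.
case mt: (meet pi rho) => /=; last first.
  have -> : affpts (pi :&: rho)%VS :\: C = affpts (pi :&: rho)%VS.
    apply/setP => Y; rewrite in_setD; case YC: (Y \in C) => //=.
    apply/esym/negbTE; apply: contraFN mt; rewrite in_affpts subv_cap => /and4P[_ _ Y1 Y2].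
    by apply/meetP; exists Y.
  rewrite cardA; have [->|d1] := eqVneq (\dim (pi :&: rho)) 2.
    by rewrite /= expn1 mul1n addn1 prednK ?q_gt0.
  have -> : \dim (pi :&: rho) = 1 by case: (\dim _) d0 d1 d2 => [|[|[|n]]].
  by rewrite /= expn0.
have [A [CA Api Ar]] := meetP _ _ mt.
have eqA : affpts (pi :&: rho)%VS :&: C = [set A].
  apply/setP => Y; rewrite in_setI in_affpts subv_cap in_set1.
  apply/idP/eqP => [/andP[/and4P[_ _ Y1 Y2] YC]|->]; last first.
    by rewrite Api Ar CA (C_point CA) (C_aff CA).
  by apply: (meet_uniq piP rP pr); rewrite inK ?YC ?Y1 ?CA.
have := cardsID C (affpts (pi :&: rho)%VS); rewrite eqA cards1 cardA.
have [->|d1] := eqVneq (\dim (pi :&: rho)) 2; first by rewrite /= expn1 mul1n addn0 add1n => <-.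
have -> : \dim (pi :&: rho) = 1 by case: (\dim _) d0 d1 d2 => [|[|[|n]]].
by rewrite /= expn0 add1n => -[].
Qed.

(** Double count of the q^2 - q affine points of [pi] outside [C], each of which lies on exactly one
    other C-plane. *)
Lemma card_line_nbrs pi : pi \in planes ->
  #|line_nbrs pi| * q.-1 + #|[set rho in parallels pi | affine Sigma (pi :&: rho)%VS]|
  = q * q.-1.
Proof.
move=> piP; pose N := affpts pi :\: C.
have cardN : #|N| = q * q.-1.
  have := cardsID C (affpts pi); rewrite card_affine ?plane_aff // plane_dim //.
  have -> : affpts pi :&: C = K pi.
    apply/setP => Y; rewrite in_setI in_affpts inK.
    by case YC: (Y \in C); rewrite ?andbF // (C_point YC) (C_aff YC) /= andbT.
  by rewrite cardK // -/N /= -mulnn; case: #|F| => [|m] /=; nia.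
have sumN : #|N| = \sum_(rho in planes :\ pi) #|affpts (pi :&: rho)%VS :\: C|.
  under [RHS]eq_bigr => rho _ do rewrite -sum1_card.
  rewrite (exchange_big_dep (mem N)) /=; last first.
    by move=> rho Y _; rewrite !inE subv_cap => /and3P[-> /andP[-> /andP[-> _]] ->].
  rewrite -sum1_card; apply: eq_bigr => Y; rewrite in_setD in_affpts.
  move=> /and4P[YC pY aY Ypi]; rewrite sum1_card.
  apply: esym; apply: etrans (other_plane pY aY YC piP Ypi).
  apply: eq_card => rho; rewrite [LHS]unfold_in /= !inE subv_cap YC pY aY Ypi /=.
  by case: (rho \in planes); rewrite ?andbF ?andbT.
rewrite -cardN sumN; under [RHS]eq_bigr => rho.
  rewrite !inE => /andP[rp rP]; rewrite count_cap //; last by rewrite eq_sym.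
  over.
rewrite big_split /= -big_distrl /=; congr (_ * _ + _).
  rewrite -sum1_card big_mkcond [RHS]big_mkcond; apply: eq_bigr => rho _.
  by rewrite !inE; case: (rho \in planes); case: (rho != pi) => //=; case: (_ && _).
rewrite -sum1_card big_mkcond [RHS]big_mkcond; apply: eq_bigr => rho _.
rewrite in_setD1 inE [rho \in parallels pi]inE.
case rP: (rho \in planes); rewrite ?andbF //=.
case: (eqVneq rho pi) => [->|_] /=; last by case: (_ && _).
by rewrite meet_self.
Qed.

(** The number of parallels with an affine common point is a multiple of q - 1 and at most q - 1,
    hence 0 or q - 1. *)
Lemma card_line_nbrs_cases pi : pi \in planes ->
  (#|line_nbrs pi| = q /\
   forall rho, rho \in planes -> ~~ meet pi rho -> (pi :&: rho <= Sigma)%VS) \/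
  [/\ #|line_nbrs pi| = q.-1, #|parallels pi| = q.-1 &
   forall rho, rho \in planes -> ~~ meet pi rho -> affine Sigma (pi :&: rho)%VS].
Proof.
move=> piP; have := card_line_nbrs piP; have := card_parallels piP.
set M := [set rho in parallels pi | _]; have sMP : M \subset parallels pi.
  by apply/subsetP => rho; rewrite inE => /andP[].
have p0 : 0 < q.-1 by rewrite -ltnS prednK ?q_gt0 // (leq_trans _ q_ge7).
have mE rho : rho \in planes -> ~~ meet pi rho ->
    (rho \in M) = affine Sigma (pi :&: rho)%VS.
  by move=> rP npr; rewrite inE [rho \in parallels pi]inE rP npr.
have := subset_leq_card sMP; have [M0|M0] := eqVneq #|M| 0 => leM leP.
  rewrite M0 addn0 => /eqP; rewrite eqn_pmul2r // => /eqP ->; left; split=> // rho rP npr.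
  by have := mE rho rP npr; rewrite (cards0_eq M0) in_set0 => /esym/negbFE.
move=> /(small_multiple_eq p0 leM leP M0)[M1 P1 L1]; right; split => // rho rP npr.
rewrite -(mE rho rP npr); have -> : M = parallels pi.
  by apply/eqP; rewrite eqEcard sMP [X in X <= _]P1 [X in _ <= X]M1 leqnn.
by rewrite inE rP npr.
Qed.

(** * Directions of affine lines and of shared lines *)

Lemma affine_line_dir l : \dim l = 2 -> affine Sigma l -> is_point (l :&: Sigma)%VS.
Proof. by move=> dl al; have := affine_dim Sigma_hyp al; rewrite dl => -[/eqP]. Qed.

Lemma affine_line_join Y l : is_point Y -> affine Sigma Y -> (Y <= l)%VS ->
  \dim l = 2 -> (Y + (l :&: Sigma))%VS = l.
Proof.
move=> pY aY Yl dl; have al := sub_affine Yl aY.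
apply: line_join => //; rewrite ?affine_line_dir ?dl ?capvSl //.
by apply: contraNneq aY => ->; exact: capvSr.
Qed.

Lemma affine_line_eq Y l m : is_point Y -> affine Sigma Y -> (Y <= l)%VS -> (Y <= m)%VS ->
  \dim l = 2 -> \dim m = 2 -> (l :&: Sigma = m :&: Sigma)%VS -> l = m.
Proof.
move=> pY aY Yl Ym dl dm eqd.
by rewrite -(affine_line_join pY aY Yl dl) eqd (affine_line_join pY aY Ym dm).
Qed.

Lemma other_affine l Y : \dim l = 2 -> affine Sigma l ->
  exists Z, [/\ is_point Z, affine Sigma Z, (Z <= l)%VS & Z != Y].
Proof.
move=> dl al; have cardl := card_affine Sigma_hyp al; rewrite dl expn1 in cardl.
have /card_gt0P[Z] : 0 < #|affpts l :\ Y|.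
  rewrite -(ltn_add2l (Y \in affpts l)) -cardsD1 cardl addn0.
  exact: leq_ltn_trans (leq_b1 _) (leq_trans _ q_ge7).
by rewrite in_setD1 in_affpts => /and4P[ZY pZ aZ Zl]; exists Z.
Qed.

Lemma line_nbrsP pi rho : rho \in line_nbrs pi ->
  [/\ rho \in planes, pi != rho, affine Sigma (pi :&: rho)%VS & \dim (pi :&: rho) = 2].
Proof. by rewrite inE => /and4P[? rp ? /eqP]; rewrite eq_sym in rp. Qed.

Lemma line_nbr_uniq pi rho sigma Y Z : pi \in planes ->
  rho \in line_nbrs pi -> sigma \in line_nbrs pi ->
  is_point Y -> affine Sigma Y -> is_point Z -> affine Sigma Z -> Y != Z ->
  (Y <= pi)%VS -> (Y <= rho)%VS -> (Y <= sigma)%VS ->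
  (Z <= pi)%VS -> (Z <= rho)%VS -> (Z <= sigma)%VS -> rho = sigma.
Proof.
move=> piP /line_nbrsP[rP pr ar dr] /line_nbrsP[sP ps as_ ds] pY aY pZ aZ YZ.
move=> Yp Yr Ys Zp Zr Zs; apply/eqP; apply: contraNT YZ => rs.
have YC := three_planes pY aY piP rP sP Yp Yr Ys pr ps rs.
have ZC := three_planes pZ aZ piP rP sP Zp Zr Zs pr ps rs.
by apply/eqP/(meet_uniq piP rP pr); rewrite inK ?YC ?ZC.
Qed.

Local Notation dir pi rho := (pi :&: rho :&: Sigma)%VS.

(** Two lines of [pi] with different points at infinity meet in an affine point, which lies on three
    C-planes and so in [C]. *)
Lemma dir_neq_meet pi rho sigma : pi \in planes ->
  rho \in line_nbrs pi -> sigma \in line_nbrs pi -> dir pi rho != dir pi sigma ->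
  exists Y, [/\ Y \in C, (Y <= pi)%VS, (Y <= rho)%VS & (Y <= sigma)%VS].
Proof.
move=> piP /line_nbrsP[rP pr ar dr] /line_nbrsP[sP ps as_ ds] dd.
have rs : rho != sigma by apply: contraNneq dd => ->.
have [Y pY] : exists2 Y, is_point Y & (Y <= (pi :&: rho) :&: (pi :&: sigma))%VS.
  apply: exists_point; have := dimv_sum_cap (pi :&: rho) (pi :&: sigma).
  have : (pi :&: rho + pi :&: sigma <= pi)%VS by rewrite subv_add !capvSl.
  move/dimvS; rewrite (plane_dim piP).
  by rewrite dr ds; move: (\dim _) (\dim _) => a b; clear; lia.
rewrite !subv_cap => /andP[/andP[Yp Yr] /andP[_ Ys]]; exists Y; split => //.
apply: (three_planes pY _ piP rP sP) => //; apply: contra dd => YS.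
have e1 : Y = dir pi rho.
  by apply: point_sub_eq; rewrite ?affine_line_dir // !subv_cap Yp Yr YS.
have e2 : Y = dir pi sigma.
  by apply: point_sub_eq; rewrite ?affine_line_dir // !subv_cap Yp Ys YS.
by rewrite -e1 -e2.
Qed.

Definition secant_dirs A pi := [set (A + B) :&: Sigma | B in K pi :\ A]%VS.

Lemma join_CC A B : A \in C -> B \in C -> A != B ->
  [/\ \dim (A + B) = 2, affine Sigma (A + B)%VS & is_point ((A + B) :&: Sigma)%VS].
Proof.
move=> CA BC AB; have dAB := dim_join (C_point CA) (C_point BC) AB.
have aAB := sub_affine (addvSl A B) (C_aff CA).
by split => //; apply: affine_line_dir.
Qed.

Lemma card_secant_dirs A pi : pi \in planes -> A \in K pi ->
  #|secant_dirs A pi| = q.-1.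
Proof.
move=> piP AK; move: (AK); rewrite inK => /andP[CA Ap].
rewrite card_in_imset; last first.
  move=> B D; rewrite !in_setD1 => /andP[BA BK] /andP[DA DK] eqd.
  move: (BK) (DK); rewrite !inK => /andP[BC Bp] /andP[DC Dp].
  rewrite eq_sym in BA; rewrite eq_sym in DA.
  have [d1 a1 _] := join_CC CA BC BA; have [d2 a2 _] := join_CC CA DC DA.
  have eql := affine_line_eq (C_point CA) (C_aff CA) (addvSl A B) (addvSl A D) d1 d2 eqd.
  apply/eqP/negPn/negP => BD.
  apply: (no_three piP AK BK DK BA DA BD d1); rewrite ?addvSl ?addvSr //.
  by rewrite eql addvSr.
by rewrite -(cardK piP) (cardsD1 A (K pi)) AK.
Qed.

Lemma secant_dirs_sub A pi : A \in K pi ->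
  secant_dirs A pi \subset points_on (pi :&: Sigma)%VS.
Proof.
rewrite inK => /andP[CA Ap]; apply/subsetP => X /imsetP[B].
rewrite in_setD1 inK => /and3P[BA BC Bp] ->.
rewrite eq_sym in BA; have [_ _ pd] := join_CC CA BC BA.
by rewrite inE pd subv_cap capvSr (subv_trans (capvSl _ _)) // subv_add Ap Bp.
Qed.

Lemma card_points_infinity pi : pi \in planes ->
  #|points_on (pi :&: Sigma)%VS| = q.+1.
Proof.
move=> piP; apply: card_points2.
by have := affine_dim Sigma_hyp (plane_aff piP); rewrite (plane_dim piP) => -[].
Qed.

(** If two directions differ, all neighbours pass through one point [Y] of [C]. The neighbour lines
    and the q - 1 secants at [Y] then have distinct points among the q + 1 at infinity, which leaves
    room for only two neighbours. *)
Lemma common_dir pi rho sigma : pi \in planes -> q.-1 <= #|line_nbrs pi| ->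
  rho \in line_nbrs pi -> sigma \in line_nbrs pi -> dir pi rho = dir pi sigma.
Proof.
move=> piP big rN sN; apply/eqP; apply: contraLR big => dd.
have [Y [YC Yp Yr Ys]] := dir_neq_meet piP rN sN dd.
have [rP pr _ _] := line_nbrsP rN; have [sP ps _ _] := line_nbrsP sN.
have pY := C_point YC; have aY := C_aff YC.
(* The direction of [tau] differs from that of [rho] or of [sigma], and [pi] shares a single point
   of [C] with each of these planes. *)
have thruY tau : tau \in line_nbrs pi -> (Y <= tau)%VS.
  move=> tN; have [e|n] := eqVneq (dir pi tau) (dir pi rho).
    rewrite -e in dd; have [Z [ZC Zp Zt Zs]] := dir_neq_meet piP tN sN dd.
    by have -> : Y = Z by apply: (meet_uniq piP sP ps); rewrite inK ?YC ?ZC.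
  have [Z [ZC Zp Zt Zr]] := dir_neq_meet piP tN rN n.
  by have -> : Y = Z by apply: (meet_uniq piP rP pr); rewrite inK ?YC ?ZC.
have YK : Y \in K pi by rewrite inK YC.
have inj : {in line_nbrs pi &, injective (fun tau => dir pi tau)}.
  move=> t1 t2 t1N t2N eqd.
  have [_ _ a1 d1] := line_nbrsP t1N; have [_ _ a2 d2] := line_nbrsP t2N.
  have Y1 : (Y <= pi :&: t1)%VS by rewrite subv_cap Yp thruY.
  have Y2 : (Y <= pi :&: t2)%VS by rewrite subv_cap Yp thruY.
  have eql := affine_line_eq pY aY Y1 Y2 d1 d2 eqd.
  have [Z [pZ aZ Z1 ZY]] := other_affine Y d1 a1.
  have := Z1; rewrite eql; move: Z1; rewrite !subv_cap => /andP[Zp Z1] /andP[_ Z2].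
  by apply: (line_nbr_uniq piP t1N t2N pZ aZ pY aY ZY); rewrite ?(thruY t1) ?(thruY t2).
set S1 := [set dir pi tau | tau in line_nbrs pi].
have dis : [disjoint S1 & secant_dirs Y pi].
  rewrite -setI_eq0; apply/eqP/setP => d; rewrite in_set0 in_setI.
  apply/negbTE/negP => /andP[/imsetP[tau tN ->] /imsetP[B]].
  rewrite in_setD1 inK => /and3P[BY BC Bp] eqd; rewrite eq_sym in BY.
  have [d1 a1 _] := join_CC YC BC BY; have [tP pt a2 d2] := line_nbrsP tN.
  have Y2 : (Y <= pi :&: tau)%VS by rewrite subv_cap Yp thruY.
  have eql := affine_line_eq pY aY Y2 (addvSl Y B) d2 d1 eqd.
  have := addvSr Y B; rewrite -eql subv_cap => /andP[_ Bt].
  by move/negP: pt; apply; apply/eqP/(plane_uniq piP tP YC BC BY); rewrite ?(thruY tau).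
have : S1 :|: secant_dirs Y pi \subset points_on (pi :&: Sigma)%VS.
  rewrite subUset secant_dirs_sub // andbT; apply/subsetP => _ /imsetP[tau tN ->].
  have [tP pt a2 d2] := line_nbrsP tN.
  by rewrite inE affine_line_dir // capvS // capvSl.
move=> /subset_leq_card; rewrite card_points_infinity //.
move: dis; rewrite -leq_card_setU => /eqP ->; rewrite card_in_imset // card_secant_dirs //.
move: #|line_nbrs pi| => n; move: q_ge7; clear; case: #|F| => [|m] //=; lia.
Qed.

(** * Parallel C-planes meet at infinity *)

(** Shared lines have a common direction, so those through [Y] coincide and provide a second affine
    point on both neighbours. *)
Lemma line_nbr_thru pi rho sigma Y : pi \in planes -> q.-1 <= #|line_nbrs pi| ->
  rho \in line_nbrs pi -> sigma \in line_nbrs pi -> is_point Y -> affine Sigma Y ->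
  (Y <= pi)%VS -> (Y <= rho)%VS -> (Y <= sigma)%VS -> rho = sigma.
Proof.
move=> piP big rN sN pY aY Yp Yr Ys.
have [_ _ a1 d1] := line_nbrsP rN; have [_ _ a2 d2] := line_nbrsP sN.
have Y1 : (Y <= pi :&: rho)%VS by rewrite subv_cap Yp.
have Y2 : (Y <= pi :&: sigma)%VS by rewrite subv_cap Yp.
have eql := affine_line_eq pY aY Y1 Y2 d1 d2 (common_dir piP big rN sN).
have [Z [pZ aZ Z1 ZY]] := other_affine Y d1 a1.
have := Z1; rewrite eql; move: Z1; rewrite !subv_cap => /andP[Zp Z1] /andP[_ Z2].
exact: (line_nbr_uniq piP rN sN pZ aZ pY aY ZY).
Qed.

Lemma card_covered pi : pi \in planes -> q.-1 <= #|line_nbrs pi| ->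
  #|[set Y in affpts pi | [exists tau in line_nbrs pi, Y <= tau]%VS]| = #|line_nbrs pi| * q.
Proof.
move=> piP big; set W := [set Y in _ | _]; rewrite -sum_nat_const.
transitivity (\sum_(tau in line_nbrs pi) #|affpts (pi :&: tau)%VS|); last first.
  apply: eq_bigr => tau tN; have [_ _ a d] := line_nbrsP tN.
  by rewrite card_affine // d /= expn1.
under [RHS]eq_bigr => rho _ do rewrite -sum1_card.
rewrite (exchange_big_dep (mem W)) /=; last first.
  move=> tau Y tN; rewrite in_affpts subv_cap => /and4P[pY aY Yp Yt].
  by rewrite inE in_affpts pY aY Yp /=; apply/existsP; exists tau; rewrite tN.
rewrite -sum1_card; apply: eq_bigr => Y; rewrite inE in_affpts.
move=> /andP[/and3P[pY aY Yp] /existsP[tau /andP[tN Yt]]].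
rewrite sum1_card; apply/esym/(eq_card1 (x := tau)) => sigma.
rewrite [LHS]unfold_in /= in_affpts subv_cap pY aY Yp [RHS]inE /=.
apply/andP/eqP => [[sN Ys]|-> //].
exact: (line_nbr_thru piP big sN tN pY aY Yp Ys Yt).
Qed.

(* The line of [pi] left over by the [q - 1] parallel lines it shares with its
   neighbours. *)
Definition is_gap pi l := [&& \dim l == 2, (l <= pi)%VS, [exists A in C, A <= l]%VS &
  [forall Y, [&& is_point Y, affine Sigma Y & Y <= pi]%VS ==>
    ((Y <= l)%VS || [exists tau in line_nbrs pi, Y <= tau]%VS)]].

(** The shared lines cover (q - 1) q of the q^2 affine points. The line in their direction through
    any point left over avoids them all, so it consists of the q points left over. *)
Lemma ex_gap pi : pi \in planes -> #|line_nbrs pi| = q.-1 ->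
  exists l, is_gap pi l.
Proof.
move=> piP cardN; have big : q.-1 <= #|line_nbrs pi| by rewrite cardN.
set W := [set Y in affpts pi | [exists tau in line_nbrs pi, Y <= tau]%VS].
have cardW : #|W| = q.-1 * q by rewrite card_covered // cardN.
have cardP : #|affpts pi| = q ^ 2 by rewrite card_affine ?plane_aff // plane_dim.
have sWP : W \subset affpts pi by apply/subsetP => Y; rewrite [Y \in W]inE => /andP[].
have cardR : #|affpts pi :\: W| = q.
  rewrite cardsD (setIidPr sWP) [X in X - _]cardP [X in _ - X]cardW.
  by clear; case: #|F| => [|m] //=; rewrite -mulnn; lia.
have inR Y : (Y \in affpts pi :\: W) =
    [&& is_point Y, affine Sigma Y & Y <= pi]%VS && ~~ [exists tau in line_nbrs pi, Y <= tau]%VS.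
  by rewrite in_setD [Y \in W]inE -in_affpts; case: (Y \in affpts pi); rewrite ?andbF ?andbT.
have /card_gt0P[tau0 t0N] : 0 < #|line_nbrs pi|.
  by rewrite cardN; move: q_ge7; clear; case: #|F| => [|[]].
have [_ _ a0 d0] := line_nbrsP t0N; set x := (pi :&: tau0 :&: Sigma)%VS.
have px : is_point x by apply: affine_line_dir.
have xS : (x <= Sigma)%VS by apply: capvSr.
have xp : (x <= pi)%VS by rewrite /x -capvA capvSl.
have /card_gt0P[Z] : 0 < #|affpts pi :\: W| by rewrite cardR q_gt0.
rewrite inR => /andP[/and3P[pZ aZ Zp] /existsPn nZ].
have Zx : Z != x by apply: contraNneq aZ => ->.
have dl : \dim (Z + x) = 2 by apply: dim_join.
have al : affine Sigma (Z + x)%VS by apply: sub_affine (addvSl _ _) aZ.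
have lp : (Z + x <= pi)%VS by rewrite subv_add Zp.
have lS : (x = (Z + x) :&: Sigma)%VS.
  by apply: point_sub_eq; rewrite ?affine_line_dir // subv_cap addvSr.
have offl Y : is_point Y -> affine Sigma Y -> (Y <= Z + x)%VS ->
    forall tau, tau \in line_nbrs pi -> ~~ (Y <= tau)%VS.
  move=> pY aY Yl tau tN; apply/negP => Yt; have [_ _ a d] := line_nbrsP tN.
  have Ypt : (Y <= pi :&: tau)%VS by rewrite subv_cap (subv_trans Yl).
  have eql : (pi :&: tau)%VS = (Z + x)%VS.
    by apply: (affine_line_eq pY aY Ypt Yl d dl); rewrite -lS; apply: common_dir.
  have := nZ tau; rewrite tN /= => /negP[].
  by apply: subv_trans (capvSr pi tau); rewrite eql addvSl.
have RE : affpts (Z + x)%VS = affpts pi :\: W.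
  apply/eqP; rewrite eqEcard cardR card_affine // dl expn1 leqnn andbT.
  apply/subsetP => Y; rewrite inR in_affpts => /and3P[pY aY Yl].
  rewrite pY aY (subv_trans Yl) //=; apply/existsPn => tau.
  by case tN: (tau \in _) => //=; apply: offl.
exists (Z + x)%VS; rewrite /is_gap dl lp /=; apply/andP; split; last first.
  apply/forallP => Y; apply/implyP => Yaff.
  have [ex|nW] := boolP [exists tau in line_nbrs pi, Y <= tau]%VS; first by rewrite orbT.
  have : Y \in affpts pi :\: W by rewrite inR Yaff.
  by rewrite -RE in_affpts => /and3P[_ _ ->].
apply/existsP; pose f A := odflt pi [pick tau in line_nbrs pi | A <= tau]%VS.
(* The arc has q points, and each of the q - 1 shared lines carries at most one of them. *)
have [A AK nA] : exists2 A, A \in K pi & ~~ [exists tau in line_nbrs pi, A <= tau]%VS.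
  apply/exists_inP; rewrite -negb_forall_in; apply/negP => /forall_inP all.
  have fP A : A \in K pi -> f A \in line_nbrs pi /\ (A <= f A)%VS.
    move=> /all /existsP[tau /andP[tN At]]; rewrite /f.
    by case: pickP => [s /andP[]|/(_ tau)] //=; rewrite tN At.
  have : f @: K pi \subset line_nbrs pi by apply/subsetP => X /imsetP[A /fP[? _] ->].
  move=> /subset_leq_card; rewrite card_in_imset ?cardN ?cardK //.
    by move: q_ge7; clear; case: #|F| => //= m _; rewrite ltnn.
  move=> A B AK BK eqf; have [N1 A1] := fP A AK; have [N2 B1] := fP B BK.
  rewrite -eqf in B1; have [fN pf _ _] := line_nbrsP N1.
  move: (AK) (BK); rewrite !inK => /andP[CA _] /andP[BC _].
  by apply: (meet_uniq piP fN pf) => //; rewrite inK ?CA ?BC.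
move: AK; rewrite inK => /andP[CA Ap]; exists A; rewrite CA /=.
have : A \in affpts pi :\: W by rewrite inR nA Ap C_aff ?C_point.
by rewrite -RE in_affpts => /and3P[_ _ ->].
Qed.

(** The lines shared with two parallel neighbours carry no point of [C]. So at most q - 3 points of
    the arc would lie off [l], leaving three on it. *)
Lemma gap_parallel_nbr pi l rho sigma : pi \in planes -> #|line_nbrs pi| = q.-1 ->
  is_gap pi l -> rho \in line_nbrs pi -> sigma \in line_nbrs pi ->
  ~~ meet pi rho -> ~~ meet pi sigma -> rho = sigma.
Proof.
move=> piP cardN /and4P[/eqP dl lp _ /forallP cov] rN sN npr nps.
apply/eqP/negPn/negP => rs.
pose f A := odflt pi [pick tau in line_nbrs pi | A <= tau]%VS.
pose Kl := [set A in K pi | A <= l]%VS.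
have fP A : A \in K pi :\: Kl -> [/\ A \in C, (A <= pi)%VS, f A \in line_nbrs pi & (A <= f A)%VS].
  rewrite in_setD [A \in Kl]inE => /andP[+ AK]; rewrite AK /= => nAl.
  move: AK; rewrite inK => /andP[CA Ap].
  have := cov A; rewrite (C_point CA) (C_aff CA) Ap (negPf nAl) /= => /existsP[tau /andP[tN At]].
  by rewrite /f; case: pickP => [s /andP[]|/(_ tau)] //=; rewrite tN At.
have : f @: (K pi :\: Kl) \subset line_nbrs pi :\: [set rho; sigma].
  apply/subsetP => X /imsetP[A /fP[CA Ap fN Af] ->].
  rewrite in_setD fN andbT; apply/negP => /set2P[] eqf.
    by move/negP: npr; apply; apply/meetP; exists A; rewrite -eqf.
  by move/negP: nps; apply; apply/meetP; exists A; rewrite -eqf.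
move=> /subset_leq_card; rewrite card_in_imset; last first.
  move=> A B /fP[CA Ap N1 A1] /fP[BC Bp N2 B1] eqf.
  rewrite -eqf in B1; have [fN pf _ _] := line_nbrsP N1.
  by apply: (meet_uniq piP fN pf); rewrite inK ?CA ?BC.
have sKl : Kl \subset K pi by apply/subsetP => A; rewrite [A \in Kl]inE => /andP[].
have srs : [set rho; sigma] \subset line_nbrs pi.
  by apply/subsetP => X /set2P[] ->.
rewrite !cardsD (setIidPr sKl) (setIidPr srs) cardN cards2 rs /= => le.
have /card_gt2P[A [B [D [[AK BK DK] [AB BD DA]]]]] : 2 < #|Kl|.
  move: le q_ge7; rewrite (cardK piP); clear; case: #|F| => [|m] /=; [by []|move: #|Kl| => k; lia].
move: AK BK DK; rewrite ![_ \in Kl]inE => /andP[AK Al] /andP[BK Bl] /andP[DK Dl].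
by apply: (no_three piP AK BK DK AB _ BD dl Al Bl Dl); rewrite eq_sym.
Qed.

(** * Excluding the case of q - 1 shared lines *)

Section GapClass.

Variable pi : PG4 F.
Hypothesis piP : pi \in planes.
Hypothesis card_par : #|parallels pi| = q.-1.
Hypothesis par_affine :
  forall rho, rho \in planes -> ~~ meet pi rho -> affine Sigma (pi :&: rho)%VS.

Let cls := pi |: parallels pi.

Lemma clsP rho : rho \in cls -> rho \in planes.
Proof. by rewrite in_setU1 => /orP[/eqP -> //|]; rewrite inE => /andP[]. Qed.

Lemma cls_meet rho sigma : rho \in cls -> sigma \in cls -> rho != sigma -> ~~ meet rho sigma.
Proof.
move=> rc sc; have rP := clsP rc; have sP := clsP sc; move: rc sc.
rewrite !in_setU1 => /orP[/eqP ->|r1] /orP[/eqP -> //|s1] rs; first by rewrite eqxx in rs.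
- by move: s1; rewrite inE => /andP[].
- by move: r1; rewrite inE meetC => /andP[].
move: r1 s1; rewrite [rho \in _]inE [sigma \in _]inE => /andP[_ n2'] /andP[_ n2].
by rewrite meetC in n2'; exact: (par_trans rP piP sP n2' n2 rs).
Qed.

Lemma card_cls : #|cls| = q.
Proof.
rewrite cardsU1 card_par inE negb_and negbK meet_self // orbT.
by rewrite add1n prednK // q_gt0.
Qed.

(** The case of q shared lines is ruled out because [rho] shares an affine point with a parallel
    member of the class: with [pi], or with any parallel if [rho] is [pi] itself. *)
Lemma cls_nbrs rho : rho \in cls -> #|line_nbrs rho| = q.-1 /\
  forall sigma, sigma \in planes -> ~~ meet rho sigma -> affine Sigma (rho :&: sigma)%VS.
Proof.
move=> rc; have rP := clsP rc; case: (card_line_nbrs_cases rP) => [[_ inf]|[]] //.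
have [s [sc rs as_]] : exists s, [/\ s \in cls, s != rho & affine Sigma (rho :&: s)%VS].
  have [e|n] := eqVneq rho pi.
    have /card_gt0P[s sp] : 0 < #|parallels pi|.
      by rewrite card_par; move: q_ge7; clear; case: #|F| => [|[]].
    have sc : s \in cls by rewrite in_setU1 sp orbT.
    move: sp; rewrite inE => /andP[sP mps]; exists s; split => //; rewrite e ?par_affine //.
    by apply: contraNneq mps => ->; apply: meet_self.
  exists pi; rewrite setU11 eq_sym; split => //; rewrite capvC par_affine //.
  by apply: cls_meet; rewrite ?setU11 // eq_sym.
have := inf s (clsP sc); rewrite (cls_meet rc sc) 1?eq_sym // => /(_ isT).
by move: as_; rewrite /affine => /negPf ->.
Qed.

Let gap rho := odflt rho [pick l | is_gap rho l].

Lemma gapP rho : rho \in cls -> is_gap rho (gap rho).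
Proof.
move=> rc; have [l lg] := ex_gap (clsP rc) (cls_nbrs rc).1.
by rewrite /gap; case: pickP => [//|/(_ l)]; rewrite lg.
Qed.

Lemma partner_uniq rho sigma tau : rho \in cls -> sigma \in cls -> tau \in cls ->
  rho != sigma -> rho != tau -> sigma != tau -> sigma \in line_nbrs rho -> tau \notin line_nbrs rho.
Proof.
move=> rc sc tc rs rt st sN; apply: contra st => tN; apply/eqP.
by apply: (gap_parallel_nbr (clsP rc) (cls_nbrs rc).1 (gapP rc) sN tN); apply: cls_meet.
Qed.

Lemma line_nbrs_sym rho sigma : rho \in cls -> sigma \in line_nbrs rho -> rho \in line_nbrs sigma.
Proof.
move=> rc /line_nbrsP[sP rs a d]; rewrite inE clsP //.
by rewrite rs capvC a d eqxx.
Qed.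

(** A neighbour of [rho] through the common point [Y] would be a third C-plane on it and put [Y] in
    [C], though the planes are parallel. So [Y] is on the gap line of either plane. *)
Lemma gap_cap rho sigma : rho \in cls -> sigma \in cls -> rho != sigma ->
  sigma \notin line_nbrs rho -> exists Y, [/\ is_point Y, affine Sigma Y, Y \notin C &
    [/\ Y <= rho, Y <= sigma, Y <= gap rho & Y <= gap sigma]%VS].
Proof.
have aux r s Y : r \in cls -> s \in cls -> r != s -> s \notin line_nbrs r ->
    is_point Y -> affine Sigma Y -> Y \notin C -> (Y <= r)%VS -> (Y <= s)%VS -> (Y <= gap r)%VS.
  move=> rc sc rs nN pY aY YC Yr Ys; have /and4P[_ _ _ /forallP/(_ Y)] := gapP rc.
  rewrite pY aY Yr /= => /orP[//|/existsP[tau /andP[tN Yt]]].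
  have [tP rt _ _] := line_nbrsP tN; move/negP: YC; case.
  apply: (three_planes pY aY (clsP rc) (clsP sc) tP Yr Ys Yt rs rt).
  by apply: contraNneq nN => ->.
move=> rc sc rs nN; have aff := (cls_nbrs rc).2 sigma (clsP sc) (cls_meet rc sc rs).
have [Y [pY aY]] := affineP Sigma_hyp aff; rewrite subv_cap => /andP[Yr Ys].
have YC : Y \notin C.
  by apply: contra (cls_meet rc sc rs) => YC; apply/meetP; exists Y.
exists Y; split => //; split => //; first exact: (aux rho sigma).
apply: (aux sigma rho) => //; first by rewrite eq_sym.
by apply: contra nN; apply: line_nbrs_sym.
Qed.

(** The gap line of [tau] meets the other two in distinct points: a common one would lie on three
    C-planes, hence in [C]. *)
Lemma gap_sub rho sigma tau : rho \in cls -> sigma \in cls -> tau \in cls ->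
  rho != sigma -> tau != rho -> tau != sigma -> tau \notin line_nbrs rho -> tau \notin line_nbrs sigma ->
  (gap tau <= gap rho + gap sigma)%VS.
Proof.
move=> rc sc tc rs tr ts nr ns; rewrite eq_sym in tr; rewrite eq_sym in ts.
have [Y [pY aY YC [Yr Yt Ygr Ygt]]] := gap_cap rc tc tr nr.
have [Z [pZ aZ ZC [Zs Zt Zgs Zgt]]] := gap_cap sc tc ts ns.
have YZ : Y != Z.
  apply: contraNneq YC => eqYZ; apply: (three_planes pY aY (clsP rc) (clsP sc) (clsP tc)) => //.
  by rewrite eqYZ.
have /and4P[/eqP dg _ _ _] := gapP tc.
rewrite -(line_join pY pZ YZ _ Ygt Zgt) ?dg // subv_add.
by rewrite (subv_trans Ygr (addvSl _ _)) (subv_trans Zgs (addvSr _ _)).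
Qed.

(** Three members that are pairwise not neighbours have gap lines in one plane [alpha], which then
    contains all gap lines and with them q points of [C]. So [alpha] is a C-plane, and the third one
    on a point outside [C]. *)
Lemma gap_class_false : False.
Proof.
have pc : pi \in cls by rewrite setU11.
have parcls s : s \in parallels pi -> s \in cls by move=> sp; rewrite in_setU1 sp orbT.
have parN s : s \in parallels pi -> pi != s.
  by rewrite inE => /andP[sP]; apply: contraNneq => <-; apply: meet_self.
have few rho : rho \in cls -> #|line_nbrs rho :&: (cls :\ rho)| <= 1.
  move=> rc; rewrite leqNgt; apply/negP => /card_gt1P[s [t [sS tS st]]].
  move: sS tS; rewrite !in_setI !in_setD1 => /and3P[sN sr sc] /and3P[tN tr tc].
  rewrite eq_sym in sr; rewrite eq_sym in tr.
  by have := partner_uniq rc sc tc sr tr st sN; rewrite tN.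
have pick2 : exists r s, [/\ r \in cls, s \in cls, pi != r, pi != s &
   [/\ r != s, r \notin line_nbrs pi, s \notin line_nbrs pi & s \notin line_nbrs r]].
  (* A member has at most one neighbour in the class, so at most three of the q - 1 >= 6 parallels
     ever have to be avoided. *)
  have escape (X : {set PG4 F}) : #|X| <= 3 -> exists2 s, s \in parallels pi & s \notin X.
    move=> X3; apply/subsetPn; apply: contraTN q_ge7 => /subset_leq_card.
    by rewrite card_par; move: #|X| X3 => k; clear; case: #|F| => [|m] //=; lia.
  have notN u v : v \in cls -> u != v -> v \notin line_nbrs u :&: (cls :\ u) -> v \notin line_nbrs u.
    by move=> vc uv; rewrite in_setI in_setD1 vc eq_sym uv !andbT.
  have [r rp nr] := escape _ (leq_trans (few pi pc) (isT : 1 <= 3)).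
  have [s sp] : exists2 s, s \in parallels pi & s \notin r |:
      ((line_nbrs pi :&: (cls :\ pi)) :|: (line_nbrs r :&: (cls :\ r))).
    apply: escape; apply: leq_trans (leq_add (leq_b1 _) (leq_trans (leq_card_setU _ _)
      (leq_add (few pi pc) (few r (parcls r rp))))); by rewrite cardsU1.
  rewrite !in_setU !negb_or in_set1 => /and3P[sr ns nrs].
  rewrite eq_sym in sr; exists r, s; rewrite !parcls ?parN //; split => //.
  by split => //; apply: notN; rewrite ?parcls ?parN.
have [r [s [rc sc pr ps [rs nr ns nrs]]]] := pick2.
have sub3 : (gap s <= gap pi + gap r)%VS by apply: gap_sub => //; rewrite eq_sym.
set alpha := (gap pi + gap r)%VS in sub3.
have suball t : t \in cls -> (gap t <= alpha)%VS.
  move=> tc; have [->|tp] := eqVneq t pi; first exact: addvSl.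
  have [->|tr] := eqVneq t r; first exact: addvSr.
  have [->|ts] := eqVneq t s; first exact: sub3.
  (* A further member [t] is a neighbour of at most one of [pi], [r] and [s]; the other two put its
     gap line in [alpha]. *)
  have excl u v : u \in cls -> v \in cls -> u != v -> t != u -> t != v ->
      t \in line_nbrs u -> t \notin line_nbrs v.
    move=> uc vc uv tu tv tN; apply/negP => tN'.
    move: (line_nbrs_sym uc tN) (line_nbrs_sym vc tN') => uN.
    by apply/negP; apply: (partner_uniq tc uc vc).
  have [tNp|tNp] := boolP (t \in line_nbrs pi).
    have n1 := excl pi r pc rc pr tp tr tNp; have n2 := excl pi s pc sc ps tp ts tNp.
    apply: subv_trans (gap_sub rc sc tc rs tr ts n1 n2) _.
    by rewrite subv_add sub3 addvSr.
  have [tNr|tNr] := boolP (t \in line_nbrs r); last exact: (gap_sub pc rc tc pr tp tr tNp tNr).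
  have n2 := excl r s rc sc rs tr ts tNr.
  apply: subv_trans (gap_sub pc sc tc ps tp ts tNp n2) _.
  by rewrite subv_add sub3 addvSl.
have [Y [pY aY YC [Yp Yr Ygp Ygr]]] := gap_cap pc rc pr nr.
have /and4P[/eqP dp lp _ _] := gapP pc; have /and4P[/eqP dr lr _ _] := gapP rc.
(* The two gap lines share [Y]. If they were equal, [pi] and [r] would share that line and be
   neighbours. *)
have dalpha : \dim alpha = 3.
  have := dimv_sum_cap (gap pi) (gap r); rewrite dp dr -/alpha.
  suff -> : \dim (gap pi :&: gap r) = 1 by rewrite addn1 => /(congr1 predn).
  have c1 : 0 < \dim (gap pi :&: gap r).
    have /dimvS : (Y <= gap pi :&: gap r)%VS by rewrite subv_cap Ygp.
    by rewrite (eqP pY).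
  apply/eqP; rewrite eqn_leq c1 andbT leqNgt; apply/negP => c2.
  have e : gap pi = gap r.
    have d1 : \dim (gap pi :&: gap r) = 2.
      by have := dimvS (capvSl (gap pi) (gap r)); rewrite dp => c3; apply/eqP; rewrite eqn_leq c2 c3.
    transitivity (gap pi :&: gap r)%VS; [apply/esym|];
      by apply: sub_eq; rewrite ?capvSl ?capvSr ?dp ?dr ?d1.
  move/negP: nr; apply; rewrite inE clsP // eq_sym pr (cls_nbrs pc).2 ?clsP ?cls_meet //=.
  have /andP[_ le2] := cap_dim (clsP pc) (clsP rc) pr.
  have /dimvS : (gap pi <= pi :&: r)%VS by rewrite subv_cap lp e lr.
  by rewrite dp eqn_leq le2.
pose f rho := odflt rho [pick A in C | A <= gap rho]%VS.
have fP rho : rho \in cls -> f rho \in C /\ (f rho <= gap rho)%VS.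
  move=> rc'; have /and4P[_ _ /existsP[A /andP[CA Ag]] _] := gapP rc'.
  by rewrite /f; case: pickP => [B /andP[]|/(_ A)] //=; rewrite CA Ag.
have gsub rho : rho \in cls -> (gap rho <= rho)%VS by move=> /gapP/and4P[].
have finj : {in cls &, injective f}.
  move=> s1 s2 c1 c2 eqf; apply/eqP; apply/negPn/negP => s12.
  move/negP: (cls_meet c1 c2 s12); apply; apply/meetP; exists (f s1).
  have [fC f1] := fP s1 c1; have [_ f2] := fP s2 c2; rewrite -eqf in f2.
  by rewrite fC (subv_trans f1) ?gsub // (subv_trans f2) ?gsub.
have alphaP : alpha \in planes.
  apply: A1_plane; first by rewrite /is_plane dalpha.
  apply: (@leq_trans #|f @: cls|); first by rewrite card_in_imset // card_cls; apply: ltnW; apply: ltnW.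
  apply/subset_leq_card/subsetP => X /imsetP[t tc ->]; have [fC fg] := fP t tc.
  by rewrite inK fC (subv_trans fg (suball t tc)).
have notalpha u v : u \in cls -> v \in cls -> u != v -> u != alpha.
  move=> uc vc uv; apply: contraNneq (cls_meet uc vc uv) => eqa.
  have [fC fg] := fP v vc; apply/meetP; exists (f v).
  by rewrite fC eqa (subv_trans fg (suball v vc)) (subv_trans fg (gsub v vc)).
move/negP: YC; apply; apply: (three_planes pY aY (clsP pc) (clsP rc) alphaP Yp Yr) => //.
- exact: subv_trans Ygp (addvSl _ _).
- exact: (notalpha pi r).
- by apply: (notalpha r pi) => //; rewrite eq_sym.
Qed.

End GapClass.

Lemma card_line_nbrs_q pi : pi \in planes -> #|line_nbrs pi| = q.
Proof.
move=> piP; case: (card_line_nbrs_cases piP) => [[] //|[_ cp aff]].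
by case: (gap_class_false piP cp aff).
Qed.

Lemma parallel_cap pi rho : pi \in planes -> rho \in planes -> ~~ meet pi rho ->
  (pi :&: rho <= Sigma)%VS.
Proof.
move=> piP rP npr; case: (card_line_nbrs_cases piP) => [[_] |[_ cp aff]]; first exact.
by case: (gap_class_false piP cp aff).
Qed.

(** * Partners and axes *)

Lemma line_nbrs_big pi : pi \in planes -> q.-1 <= #|line_nbrs pi|.
Proof. by move=> piP; rewrite card_line_nbrs_q // leq_pred. Qed.

Lemma nbr_uniq pi rho sigma A : pi \in planes -> rho \in line_nbrs pi -> sigma \in line_nbrs pi ->
  A \in C -> (A <= pi)%VS -> (A <= rho)%VS -> (A <= sigma)%VS -> rho = sigma.
Proof.
move=> piP rN sN CA; exact: (line_nbr_thru piP (line_nbrs_big piP) rN sN (C_point CA) (C_aff CA)).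
Qed.

Lemma nbr_meet pi rho : pi \in planes -> rho \in line_nbrs pi -> meet pi rho.
Proof.
move=> piP /line_nbrsP[rP _ a _]; apply: contraT => npr.
by have := parallel_cap piP rP npr; move: a; rewrite /affine => /negPf ->.
Qed.

Lemma nbr_sym pi rho : pi \in planes -> rho \in line_nbrs pi -> pi \in line_nbrs rho.
Proof.
by move=> piP /line_nbrsP[rP pr a d]; rewrite inE piP pr capvC a d eqxx.
Qed.

Lemma nbr_of_dim pi rho A : pi \in planes -> rho \in planes -> pi != rho -> A \in C ->
  (A <= pi)%VS -> (A <= rho)%VS -> 1 < \dim (pi :&: rho) -> rho \in line_nbrs pi.
Proof.
move=> piP rP pr CA Ap Ar d1; have /andP[_ d2] := cap_dim piP rP pr.
rewrite inE rP eq_sym pr eqn_leq d1 d2 !andbT /=.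
by apply: sub_affine (C_aff CA); rewrite subv_cap Ap.
Qed.

Lemma nbr_of_infinity pi rho A d : pi \in planes -> rho \in planes -> pi != rho -> A \in C ->
  (A <= pi)%VS -> (A <= rho)%VS -> is_point d -> (d <= Sigma)%VS ->
  (d <= pi)%VS -> (d <= rho)%VS -> rho \in line_nbrs pi.
Proof.
move=> piP rP pr CA Ap Ar pd dS dp dr; apply: (nbr_of_dim piP rP pr CA Ap Ar).
have Ad : A != d by apply: contraNneq (C_aff CA) => ->.
have /dimvS : (A + d <= pi :&: rho)%VS by rewrite subv_add !subv_cap Ap Ar dp dr.
by rewrite (dim_join (C_point CA) pd Ad).
Qed.

Definition partner pi A := odflt pi [pick rho in line_nbrs pi | A <= rho]%VS.

(** Each of the q neighbours meets [pi] in a point of [C], different ones in different points, so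
    all q points of the arc are reached. *)
Lemma partnerP pi A : pi \in planes -> A \in C -> (A <= pi)%VS ->
  partner pi A \in line_nbrs pi /\ (A <= partner pi A)%VS.
Proof.
move=> piP CA Ap.
pose f rho := odflt A [pick B in K pi | B <= rho]%VS.
have fP rho : rho \in line_nbrs pi ->
    [/\ f rho \in K pi, f rho \in C, (f rho <= pi)%VS & (f rho <= rho)%VS].
  move=> rN; have /meetP[B [BC Bp Br]] := nbr_meet piP rN.
  rewrite /f; case: pickP => [D /andP[DK Dr]|/(_ B)] /=; last by rewrite inK BC Bp Br.
  by split=> //; move: DK; rewrite inK => /andP[].
have inj : {in line_nbrs pi &, injective f}.
  move=> r s rN sN eqf; have [_ fC fp fr] := fP r rN; have [_ _ _ fs] := fP s sN.
  by rewrite -eqf in fs; apply: (nbr_uniq piP rN sN fC).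
have : A \in f @: line_nbrs pi.
  suff -> : f @: line_nbrs pi = K pi by rewrite inK CA.
  apply/eqP; rewrite eqEcard card_in_imset // card_line_nbrs_q // cardK // leqnn andbT.
  by apply/subsetP => X /imsetP[r rN ->]; have [] := fP r rN.
move=> /imsetP[r rN Ar]; have [_ _ _ fr] := fP r rN; rewrite -Ar in fr.
by rewrite /partner; case: pickP => [s /andP[]|/(_ r)] //=; rewrite rN fr.
Qed.

Lemma ex_C pi : pi \in planes -> exists2 A, A \in C & (A <= pi)%VS.
Proof.
move=> piP; have /card_gt0P[A] : 0 < #|K pi| by rewrite (cardK piP) q_gt0.
by rewrite inK => /andP[CA Ap]; exists A.
Qed.

Lemma ex_nbr pi : pi \in planes -> exists rho, rho \in line_nbrs pi.
Proof.
move=> piP; apply/card_gt0P; by rewrite card_line_nbrs_q // q_gt0.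
Qed.

(* The point [pi_infty] completing [K pi] to a conic. *)
Definition axis pi := odflt pi (omap (fun rho => dir pi rho) [pick rho in line_nbrs pi]).

Lemma axis_nbr pi rho : pi \in planes -> rho \in line_nbrs pi -> dir pi rho = axis pi.
Proof.
move=> piP rN; rewrite /axis; case: pickP => [s sN|/(_ rho)] /=; last by rewrite rN.
exact: common_dir (line_nbrs_big piP) rN sN.
Qed.

Lemma axisP pi : pi \in planes -> [/\ is_point (axis pi), (axis pi <= pi)%VS & (axis pi <= Sigma)%VS].
Proof.
move=> piP; have [rho rN] := ex_nbr piP; rewrite -(axis_nbr piP rN).
have [_ _ a d] := line_nbrsP rN.
by rewrite affine_line_dir // capvSr -capvA capvSl.
Qed.

Lemma nbr_axis pi rho : pi \in planes -> rho \in line_nbrs pi -> axis rho = axis pi.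
Proof.
move=> piP rN; have [rP _ _ _] := line_nbrsP rN.
by rewrite -(axis_nbr rP (nbr_sym piP rN)) -(axis_nbr piP rN) (capvC rho).
Qed.

Lemma same_axis_nbr pi rho A : pi \in planes -> rho \in planes -> pi != rho -> A \in C ->
  (A <= pi)%VS -> (A <= rho)%VS -> axis pi = axis rho -> rho \in line_nbrs pi.
Proof.
move=> piP rP pr CA Ap Ar eqa; have [pa ap aS] := axisP piP; have [_ ar _] := axisP rP.
by apply: (nbr_of_infinity piP rP pr CA Ap Ar pa aS ap); rewrite eqa.
Qed.

(** The line from [A] to the axis lies in the partner of [pi] at [A], which shares only one point of
    [C] with [pi]. *)
Lemma axis_line pi A B : pi \in planes -> A \in C -> (A <= pi)%VS -> B \in C ->
  (B <= A + axis pi)%VS -> B = A.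
Proof.
move=> piP CA Ap BC BA; have [rN Ar] := partnerP piP CA Ap.
have [rP pr _ _] := line_nbrsP rN; have [pa ap aS] := axisP piP.
have ar : (axis pi <= partner pi A)%VS by rewrite -(nbr_axis piP rN); have [] := axisP rP.
have Bp : (B <= pi)%VS by apply: subv_trans BA _; rewrite subv_add Ap.
have Br : (B <= partner pi A)%VS by apply: subv_trans BA _; rewrite subv_add Ar.
by apply: (meet_uniq piP rP pr); rewrite inK ?BC ?CA.
Qed.

(** * Solids spanned by neighbours, and the axes of parallel planes *)

Lemma solid_dim pi rho : pi \in planes -> rho \in line_nbrs pi -> \dim (pi + rho) = 4.
Proof.
move=> piP /line_nbrsP[rP _ _ d]; have := dimv_sum_cap pi rho.
by rewrite d (plane_dim piP) (plane_dim rP) addn2 => -[].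
Qed.

Lemma plane_solid pi sigma S : \dim pi = 3 -> \dim sigma = 3 -> \dim S = 4 ->
  (pi <= S)%VS -> (sigma <= S)%VS -> 1 < \dim (pi :&: sigma).
Proof.
move=> dp ds dS pS sS; have := dimv_sum_cap pi sigma.
have /dimvS : (pi + sigma <= S)%VS by rewrite subv_add pS.
by rewrite dp ds dS; move: (\dim _) (\dim _) => a b; clear; lia.
Qed.

Lemma plane_solid_line sigma S : \dim sigma = 3 -> \dim S = 4 -> ~~ (sigma <= S)%VS ->
  \dim (sigma :&: S) = 2.
Proof.
move=> ds dS nS; have := dimv_sum_cap sigma S; have := dim_le5 (sigma + S).
have : \dim (sigma :&: S) < 3.
  rewrite ltnNge; apply: contra nS => d3.
  by apply/capv_idPl; apply: sub_eq; rewrite ?capvSl // ds.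
have : 4 < \dim (sigma + S).
  rewrite ltnNge; apply: contra nS => d4.
  by rewrite (sub_eq (addvSr sigma S)) ?addvSl // dS.
by rewrite ds dS; move: (\dim _) (\dim _) => a b; clear; lia.
Qed.

(** Otherwise three C-planes through [B] have the axis of [pi], and one of them has the two others
    as neighbours at the same point [B]. *)
Lemma C_solid pi rho B : pi \in planes -> rho \in line_nbrs pi -> B \in C ->
  (B <= pi + rho)%VS -> (B <= pi)%VS || (B <= rho)%VS.
Proof.
move=> piP rN BC BS; apply: contraT; rewrite negb_or => /andP[nBp nBr].
have [rP pr _ _] := line_nbrsP rN; have /meetP[A [CA Ap Ar]] := nbr_meet piP rN.
have AB : A != B by apply: contraNneq nBp => <-.
have axisT sigma : sigma \in planes -> (B <= sigma)%VS -> meet pi sigma -> meet rho sigma ->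
    ~~ (A <= sigma)%VS -> axis sigma = axis pi.
  move=> sP Bs /meetP[X [XC Xp Xs]] /meetP[Y [YC Yr Ys]] nAs.
  have ps : pi != sigma by apply: contraNneq nBp => ->.
  (* Otherwise [sigma] would meet the solid in a line containing the three points [X], [Y] and [B]
     of its arc. *)
  have sS : (sigma <= pi + rho)%VS.
    apply: contraT => nS.
    have d2 := plane_solid_line (plane_dim sP) (solid_dim piP rN) nS.
    have XS := subv_trans Xp (addvSl pi rho); have YS := subv_trans Yr (addvSr pi rho).
    have XK : X \in K sigma by rewrite inK XC.
    have YK : Y \in K sigma by rewrite inK YC.
    have BK : B \in K sigma by rewrite inK BC.
    have XY : X != Y.
      apply: contraNneq nAs => eqXY; rewrite -eqXY in Yr.
      suff -> : A = X by [].
      by apply: (meet_uniq piP rP pr); rewrite inK ?CA ?XC.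
    have XB : X != B by apply: contraNneq nBp => <-.
    have YB : Y != B by apply: contraNneq nBr => <-.
    by case: (no_three sP XK YK BK XY XB YB d2); rewrite subv_cap ?Xs ?Ys ?Bs.
  apply: (nbr_axis piP); apply: (nbr_of_dim piP sP ps XC Xp Xs).
  by apply: (plane_solid (plane_dim piP) (plane_dim sP) (solid_dim piP rN)); rewrite ?addvSl.
(* The planes through [B] to be discarded: the parallel to [pi], the parallel to [rho] and the one
   through [A]. At least q - 2 remain. *)
pose T := [set s in pencil B | ~~ meet pi s] :|: [set s in pencil B | ~~ meet rho s]
   :|: [set s in pencil B | A <= s]%VS.
have cardT : #|T| <= 3.
  have c3 : #|[set s in pencil B | A <= s]%VS| <= 1.
    rewrite leqNgt; apply/negP => /card_gt1P[s [t [sS tS /eqP]]]; case; move: sS tS.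
    rewrite inE [s \in _]inE inE [t \in _]inE => /andP[/andP[sP Bs] As] /andP[/andP[tP Bt] At].
    exact: (plane_uniq sP tP CA BC AB).
  have c1 : #|[set s in pencil B | ~~ meet pi s]| <= 1 by rewrite (parallel_card piP BC nBp).
  have c2 : #|[set s in pencil B | ~~ meet rho s]| <= 1 by rewrite (parallel_card rP BC nBr).
  apply: leq_trans (leq_card_setU _ _) _.
  exact: leq_add (leq_trans (leq_card_setU _ _) (leq_add c1 c2)) c3.
have [s1 [s2 [s3 [[i1 i2 i3] [n12 n23 n31]]]]] : exists x y z,
   [/\ x \in pencil B :\: T, y \in pencil B :\: T & z \in pencil B :\: T] /\
   [/\ x != y, y != z & z != x].
  apply/card_gt2P; rewrite cardsD card_pencil //.
  have : #|pencil B :&: T| <= 3 by apply: leq_trans cardT; apply/subset_leq_card/subsetIr.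
  by move: #|_ :&: _| q_ge7 => k; clear; case: #|F| => [|m] //=; lia.
have inT s : s \in pencil B :\: T -> [/\ s \in planes, (B <= s)%VS & axis s = axis pi].
  rewrite in_setD !in_setU !negb_or => /andP[/andP[/andP[n1 n2] n3] sB].
  move: n1; rewrite inE sB negbK => m1; move: n2; rewrite inE sB negbK => m2.
  move: n3; rewrite inE sB /= => nA.
  by move: sB; rewrite inE => /andP[sP Bs]; split => //; apply: axisT.
have [s1P B1 a1] := inT _ i1; have [s2P B2 a2] := inT _ i2; have [s3P B3 a3] := inT _ i3.
have N2 : s2 \in line_nbrs s1 by apply: (same_axis_nbr s1P s2P n12 BC) => //; rewrite a1.
have N3 : s3 \in line_nbrs s1.
  by apply: (same_axis_nbr s1P s3P _ BC) => //; rewrite ?a1 // eq_sym.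
by rewrite (nbr_uniq s1P N2 N3 BC) ?eqxx in n23.
Qed.

(** Otherwise [sigma] lies in the solid of [pi] and [rho], so its arc is contained in these two
    planes, each of which contributes only one point. *)
Lemma same_axis_triangle pi rho sigma : pi \in planes -> rho \in planes -> sigma \in planes ->
  pi != rho -> pi != sigma -> rho != sigma -> axis rho = axis pi -> axis sigma = axis pi ->
  meet pi rho -> meet pi sigma -> ~~ meet rho sigma.
Proof.
move=> piP rP sP pr ps rs ar as_ /meetP[A [CA Ap Ar]] /meetP[B [BC Bp Bs]].
apply/negP => /meetP[D [DC Dr Ds]].
have rN : rho \in line_nbrs pi by apply: (same_axis_nbr piP rP pr CA).
have sN : sigma \in line_nbrs pi by apply: (same_axis_nbr piP sP ps BC).
have sNr : sigma \in line_nbrs rho by apply: (same_axis_nbr rP sP rs DC) => //; rewrite ar.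
have AB : A != B.
  by apply: contraNneq rs => eqAB; apply/eqP/(nbr_uniq piP rN sN CA) => //; rewrite eqAB.
(* Otherwise the lines of [sigma] with [pi] and with [rho] both equal its section by the solid, and
   [B] becomes a second point of [C] common to [pi] and [rho]. *)
have sS : (sigma <= pi + rho)%VS.
  have [_ _ a1 d1] := line_nbrsP sN; have [_ _ a2 d2] := line_nbrsP sNr.
  apply/negPn/negP => nS.
  have d := plane_solid_line (plane_dim sP) (solid_dim piP rN) nS.
  have e1 : (pi :&: sigma)%VS = (sigma :&: (pi + rho))%VS.
    apply: sub_eq; last by rewrite d d1.
    by rewrite subv_cap capvSr (subv_trans (capvSl _ _) (addvSl _ _)).
  have e2 : (rho :&: sigma)%VS = (sigma :&: (pi + rho))%VS.
    apply: sub_eq; last by rewrite d d2.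
    by rewrite subv_cap capvSr (subv_trans (capvSl _ _) (addvSr _ _)).
  have : (B <= rho :&: sigma)%VS by rewrite e2 -e1 subv_cap Bp.
  rewrite subv_cap => /andP[Br _]; move/negP: AB; apply; apply/eqP.
  by apply: (meet_uniq piP rP pr); rewrite inK ?CA ?BC.
have : 2 < #|K sigma| by rewrite cardK //; apply: leq_trans q_ge7.
have cov : K sigma \subset [set B; D].
  apply/subsetP => X; rewrite inK => /andP[XC Xs]; rewrite in_set2.
  case/orP: (C_solid piP rN XC (subv_trans Xs sS)) => Xin; apply/orP.
    by left; apply/eqP/(meet_uniq piP sP ps); rewrite inK ?XC ?BC.
  by right; apply/eqP/(meet_uniq rP sP rs); rewrite inK ?XC ?DC.
have := subset_leq_card cov; rewrite cards2; move: #|K sigma| => k; case: (B != D) => /= le gt.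
  by have := leq_trans gt le.
by have := leq_trans gt le.
Qed.

(** Let [sigma] be a partner of [pi], and take the partner of [sigma] at its point on [rho]. It has
    the axis of [pi], so it is parallel to [pi] by [same_axis_triangle], and uniqueness of parallels
    identifies it with [rho]. *)
Lemma parallel_axis pi rho : pi \in planes -> rho \in planes -> ~~ meet pi rho ->
  axis rho = axis pi.
Proof.
move=> piP rP npr; have [A CA Ap] := ex_C piP.
have [sN As] := partnerP piP CA Ap; set sigma := partner pi A in sN As.
have [sP ps _ _] := line_nbrsP sN.
have /meetP[D [DC Ds Dr]] : meet sigma rho.
  apply: contraT => nsr; have : ~~ meet pi sigma.
    by apply: (par_trans piP rP sP npr _ ps); rewrite meetC.
  by rewrite (nbr_meet piP sN).
have [tN Dt] := partnerP sP DC Ds; set tau := partner sigma D in tN Dt.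
have [tP st _ _] := line_nbrsP tN.
have atau : axis tau = axis pi by rewrite (nbr_axis sP tN) (nbr_axis piP sN).
have pt : pi != tau.
  by apply: contraNneq npr => ->; apply/meetP; exists D.
have npt : ~~ meet pi tau.
  have sp : sigma != pi by rewrite eq_sym.
  apply: (same_axis_triangle sP piP tP sp st pt _ (nbr_axis sP tN) _ (nbr_meet sP tN)).
    exact/esym/(nbr_axis piP).
  by rewrite meetC; apply: nbr_meet.
by rewrite (parallel_uniq piP DC rP tP Dr Dt npr npt).
Qed.

(** If a given partner misses [E], its parallel through [E] has the axis of [pi] and meets [pi], so
    it is a partner too. *)
Lemma partner_cover pi E : pi \in planes -> E \in C -> ~~ (E <= pi)%VS ->
  exists D, [/\ D \in C, (D <= pi)%VS & (E <= partner pi D)%VS].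
Proof.
move=> piP EC nE; have [A CA Ap] := ex_C piP.
have [rN Ar] := partnerP piP CA Ap; set rho := partner pi A in rN Ar.
have [rP pr _ _] := line_nbrsP rN.
have [Er|nEr] := boolP (E <= rho)%VS; first by exists A.
have [sigma [sP Es nrs]] := ex_parallel rP EC nEr.
have eqa : axis sigma = axis pi by rewrite (parallel_axis rP sP nrs) (nbr_axis piP rN).
have ps : pi != sigma by apply: contraNneq nE => ->.
have /meetP[D [DC Dp Ds]] : meet pi sigma.
  apply: contraT => nps; have : ~~ meet pi rho by apply: (par_trans piP sP rP) => //; rewrite meetC.
  by rewrite (nbr_meet piP rN).
have sN : sigma \in line_nbrs pi by apply: (same_axis_nbr piP sP ps DC).
have [tN Dt] := partnerP piP DC Dp.
by exists D; rewrite (nbr_uniq piP tN sN DC).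
Qed.

(** Otherwise the q - 1 points of the arc of [sigma] other than [B], where [sigma] is the parallel
    of [rho] through [B], inject into the q - 2 points of the arc of [pi] other than [A] and [B]. *)
Lemma axis_notin_solid pi rho A : pi \in planes -> rho \in planes -> A \in C ->
  (A <= pi)%VS -> (A <= rho)%VS -> pi != rho -> rho \notin line_nbrs pi ->
  ~~ (axis rho <= pi + partner pi A)%VS.
Proof.
move=> piP rP CA Ap Ar pr nN; apply/negP => aS.
have [pa ar aSig] := axisP rP.
have nap : ~~ (axis rho <= pi)%VS.
  by apply: contra nN => ap; apply: (nbr_of_infinity piP rP pr CA Ap Ar pa).
have [B [BC Bp AB]] : exists B, [/\ B \in C, (B <= pi)%VS & A != B].
  have /card_gt0P[B] : 0 < #|K pi :\ A|.
    rewrite -(ltn_add2l (A \in K pi)) -cardsD1 (cardK piP) inK CA Ap.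
    by apply: leq_trans q_ge7.
  by rewrite in_setD1 inK eq_sym => /and3P[? ? ?]; exists B.
have nBr : ~~ (B <= rho)%VS.
  by apply: contra pr => Br; apply/eqP/(plane_uniq piP rP CA BC).
have [sigma [sP Bs nrs]] := ex_parallel rP BC nBr.
have eqa : axis sigma = axis rho := parallel_axis rP sP nrs.
have ps : pi != sigma.
  by apply: contraNneq nrs => <-; apply/meetP; exists A.
have nsN : sigma \notin line_nbrs pi.
  apply: contra nap => sN; rewrite -eqa (nbr_axis piP sN); by have [] := axisP piP.
have d2 D : D \in C -> (D <= pi)%VS -> \dim (sigma :&: (pi + partner pi D)) = 2.
  move=> DC Dp; have [tN _] := partnerP piP DC Dp.
  apply: (plane_solid_line (plane_dim sP) (solid_dim piP tN)); apply: contra nsN => sS.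
  apply: (nbr_of_dim piP sP ps BC Bp Bs).
  by apply: (plane_solid (plane_dim piP) (plane_dim sP) (solid_dim piP tN)); rewrite ?addvSl.
have offpi E : E \in C -> (E <= sigma)%VS -> E != B -> ~~ (E <= pi)%VS.
  move=> EC Es; apply: contra => Ep; apply/eqP.
  by apply: (meet_uniq piP sP ps); rewrite inK ?EC ?BC.
pose f E := odflt E [pick D in K pi | E <= partner pi D]%VS.
have fP E : E \in K sigma :\ B -> [/\ f E \in C, (f E <= pi)%VS & (E <= partner pi (f E))%VS].
  rewrite in_setD1 inK => /and3P[EB EC Es].
  have [D [DC Dp ED]] := partner_cover piP EC (offpi E EC Es EB).
  rewrite /f; case: pickP => [X /andP[]|/(_ D)] /=; last by rewrite inK DC Dp ED.
  by rewrite inK => /andP[].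
have : f @: (K sigma :\ B) \subset K pi :\ A :\ B.
  apply/subsetP => X /imsetP[E ES ->]; have [fC fp Ef] := fP E ES.
  move: ES; rewrite in_setD1 inK => /and3P[EB EC Es].
  have [tN ft] := partnerP piP fC fp; have [tP pt _ _] := line_nbrsP tN.
  (* The image is not [B], since the partner at [B] would share [B] and [E] with [sigma] and
     coincide with it. *)
  rewrite !in_setD1 inK fC fp /= andbT; apply/andP; split; apply/eqP => eqf.
    rewrite eqf in ft tN tP Ef; move/negP: nsN; apply.
    by rewrite (plane_uniq sP tP EC BC EB Es Bs Ef ft).
  rewrite eqf in Ef.
  (* The image is not [A] either: since the solid at [A] is assumed to contain the axis, it cuts
     [sigma] in the line from [B] to the axis, where [B] is the only point of [C]. *)
  have dBa : (B + axis sigma)%VS = (sigma :&: (pi + partner pi A))%VS.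
    have [pas as_ aSs] := axisP sP.
    have Ba : B != axis sigma by apply: contraNneq (C_aff BC) => ->.
    apply: sub_eq; last by rewrite d2 // dim_join // C_point.
    by rewrite subv_add !subv_cap Bs (subv_trans Bp (addvSl _ _)) as_ eqa aS.
  move/negP: EB; apply; apply/eqP/(axis_line sP BC Bs EC).
  by rewrite dBa subv_cap Es (subv_trans Ef (addvSr _ _)).
(* Two points with the same image would lie with [B] on the line in which a solid meets [sigma],
   giving three collinear points of an arc. *)
move=> /subset_leq_card; rewrite card_in_imset; last first.
  move=> E E' ES ES' eqf; have [fC fp Ef] := fP E ES; have [_ _ Ef'] := fP E' ES'.
  rewrite -eqf in Ef'; move: ES ES'; rewrite !in_setD1 => /andP[EB EK] /andP[EB' EK'].
  move: (EK) (EK'); rewrite !inK => /andP[EC Es] /andP[EC' Es'].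
  apply/eqP/negPn/negP => EE; have BK : B \in K sigma by rewrite inK BC.
  apply: (no_three sP EK EK' BK EE EB EB' (d2 (f E) fC fp)); rewrite subv_cap ?Es ?Es' ?Bs /=.
  - exact: subv_trans Ef (addvSr _ _).
  - exact: subv_trans Ef' (addvSr _ _).
  - exact: subv_trans Bp (addvSl _ _).
have c1 : (#|K sigma :\ B|).+1 = q by rewrite -(cardK sP) (cardsD1 B (K sigma)) inK BC Bs.
have c2 : (#|K pi :\ A :\ B|).+2 = q.
  rewrite -(cardK piP) (cardsD1 A (K pi)) inK CA Ap (cardsD1 B (K pi :\ A)) in_setD1 inK.
  by rewrite BC Bp eq_sym AB.
by rewrite -ltnS c1 -ltnS c2 ltnn.
Qed.

(** * Tangents *)

(** Of the q + 1 points of [pi] at infinity, q - 1 lie on secants through [A], and the axis is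
    another one by [axis_line]. *)
Lemma ex_tangent pi A : pi \in planes -> A \in C -> (A <= pi)%VS ->
  exists u, points_on (pi :&: Sigma)%VS :\: secant_dirs A pi :\ axis pi = [set u].
Proof.
move=> piP CA Ap; apply/cards1P.
have AK : A \in K pi by rewrite inK CA.
have [pa ap aS] := axisP piP.
have nax : axis pi \notin secant_dirs A pi.
  apply/imsetP => -[B]; rewrite in_setD1 inK eq_sym => /and3P[AB BC Bp] eqa.
  have [d1 a1 pd] := join_CC CA BC AB.
  have : B = A.
    apply: (axis_line piP CA Ap BC); rewrite eqa.
    by rewrite (affine_line_join (C_point CA) (C_aff CA) (addvSl A B) d1) addvSr.
  by move/eqP; rewrite eq_sym (negPf AB).
have := cardsD1 (axis pi) (points_on (pi :&: Sigma)%VS :\: secant_dirs A pi).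
rewrite in_setD nax inE pa subv_cap ap aS /= cardsD (setIidPr (secant_dirs_sub AK)).
rewrite card_points_infinity // card_secant_dirs //.
set n := #|_ :\ _|; move=> eq; apply/eqP.
by move: eq q_ge7; clearbody n; clear; case: #|F| => [|m] //=; lia.
Qed.

Definition tangent_dir pi A :=
  odflt pi [pick u in points_on (pi :&: Sigma)%VS :\: secant_dirs A pi :\ axis pi].

Lemma tangent_dirP pi A u : pi \in planes -> A \in C -> (A <= pi)%VS ->
  (u \in points_on (pi :&: Sigma)%VS :\: secant_dirs A pi :\ axis pi) = (u == tangent_dir pi A).
Proof.
move=> piP CA Ap; have [v eqv] := ex_tangent piP CA Ap; rewrite /tangent_dir eqv in_set1.
by case: pickP => [w|/(_ v)]; rewrite in_set1 ?eqxx // => /eqP ->.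
Qed.

Lemma tangent_dir_spec pi A : pi \in planes -> A \in C -> (A <= pi)%VS ->
  let u := tangent_dir pi A in
  [/\ is_point u, (u <= pi)%VS, (u <= Sigma)%VS, u \notin secant_dirs A pi & u != axis pi].
Proof.
move=> piP CA Ap; have := tangent_dirP (tangent_dir pi A) piP CA Ap.
rewrite eqxx in_setD1 in_setD [_ \in points_on _]inE subv_cap /=.
by move=> /and5P[? ? ? ? ?]; split.
Qed.

(** Planes through [A] with a common point at infinity are neighbours, and that point is their axis,
    which is no tangent direction. *)
Lemma tangent_dir_inj pi rho A : pi \in planes -> rho \in planes -> A \in C ->
  (A <= pi)%VS -> (A <= rho)%VS -> tangent_dir pi A = tangent_dir rho A -> pi = rho.
Proof.
move=> piP rP CA Ap Ar eqt; apply/eqP/negPn/negP => pr.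
have [pu up uS us ua] := tangent_dir_spec piP CA Ap.
have [_ ur _ _ _] := tangent_dir_spec rP CA Ar; rewrite -eqt in ur.
have rN := nbr_of_infinity piP rP pr CA Ap Ar pu uS up ur.
have [_ _ a d] := line_nbrsP rN.
move/negP: ua; apply; rewrite -(axis_nbr piP rN); apply/eqP/point_sub_eq => //.
  exact: affine_line_dir.
by rewrite !subv_cap up ur uS.
Qed.

(** A plane [rho] outside the solid meets it in a line through [A]. Its point at infinity is not the
    axis, by [axis_notin_solid], nor on a secant, by [C_solid]; only the tangent direction is
    left. *)
Lemma tangent_dir_solid pi rho A : pi \in planes -> rho \in planes -> A \in C ->
  (A <= pi)%VS -> (A <= rho)%VS -> (tangent_dir rho A <= pi + partner pi A)%VS.
Proof.
move=> piP rP CA Ap Ar; have [tN At] := partnerP piP CA Ap; set tau := partner pi A in tN At *.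
have [tP pt _ _] := line_nbrsP tN.
have [_ ur _ _ _] := tangent_dir_spec rP CA Ar.
have [eqp|pr] := eqVneq pi rho; first by apply: subv_trans ur _; rewrite -eqp addvSl.
have [rN|nN] := boolP (rho \in line_nbrs pi).
  by apply: subv_trans ur _; rewrite (nbr_uniq piP tN rN CA) // addvSr.
have nS : ~~ (rho <= pi + tau)%VS.
  apply: contra nN => rS; apply: (nbr_of_dim piP rP pr CA Ap Ar).
  by apply: (plane_solid (plane_dim piP) (plane_dim rP) (solid_dim piP tN)); rewrite ?addvSl.
have dl := plane_solid_line (plane_dim rP) (solid_dim piP tN) nS.
have Al : (A <= rho :&: (pi + tau))%VS by rewrite subv_cap Ar (subv_trans Ap (addvSl _ _)).
have al := sub_affine Al (C_aff CA).
set d := (rho :&: (pi + tau) :&: Sigma)%VS.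
have pd : is_point d by apply: affine_line_dir.
have dS : (d <= pi + tau)%VS by rewrite /d capvC capvA capvSr.
suff : d == tangent_dir rho A by move/eqP <-.
rewrite -tangent_dirP // in_setD1 in_setD inE pd /= subv_cap capvSr andbT.
have -> : (d <= rho)%VS by rewrite /d -capvA capvSl.
rewrite andbT; apply/andP; split.
  by apply: contraTneq dS => ->; apply: axis_notin_solid.
apply/imsetP => -[B]; rewrite in_setD1 inK eq_sym => /and3P[AB BC Br] eqd.
have [d1 a1 _] := join_CC CA BC AB.
have eql := affine_line_eq (C_point CA) (C_aff CA) Al (addvSl A B) dl d1 eqd.
have : (B <= rho :&: (pi + tau))%VS by rewrite eql addvSr.
rewrite subv_cap => /andP[_ BS].
case/orP: (C_solid piP tN BC BS) => Bin.
  by move/negP: pr; apply; apply/eqP/(plane_uniq piP rP CA BC AB).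
by move/negP: nN; apply; rewrite -(plane_uniq tP rP CA BC AB).
Qed.

Lemma tangent_dirs_line A : A \in C -> exists l,
  [/\ is_line l, (l <= Sigma)%VS & [set tangent_dir pi A | pi in pencil A] = points_on l].
Proof.
move=> CA; have cp := card_pencil CA.
have /card_gt0P[pi pip] : 0 < #|pencil A| by rewrite cp.
have [piP Ap] : pi \in planes /\ (A <= pi)%VS by move: pip; rewrite inE => /andP.
have [tN At] := partnerP piP CA Ap; set tau := partner pi A in tN At.
(* A plane through [A] other than [pi] and its partner yields a second solid. The two intersect in a
   plane, which meets [Sigma] in a line with just as many points as there are tangent directions. *)
have /subsetPn[rho] : ~~ (pencil A \subset [set pi; tau]).
  apply: contraTN q_ge7 => /subset_leq_card; rewrite cp cards2 ltnS -ltnNge ltnS => le.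
  by apply: leq_trans le (leq_trans (leq_b1 _) _).
rewrite in_set2 negb_or inE => /andP[rP Ar] /andP[rp rt].
have [sN As] := partnerP rP CA Ar; set sigma := partner rho A in sN As.
rewrite eq_sym in rp.
have nN : rho \notin line_nbrs pi.
  by apply: contra rt => rN; apply/eqP/(nbr_uniq piP rN tN CA).
have nS : ~~ (rho <= pi + tau)%VS.
  apply: contra nN => rS; apply: (nbr_of_dim piP rP rp CA Ap Ar).
  by apply: (plane_solid (plane_dim piP) (plane_dim rP) (solid_dim piP tN)); rewrite ?addvSl.
set U := ((pi + tau) :&: (rho + sigma))%VS.
have dU : \dim U = 3.
  have := dimv_sum_cap (pi + tau) (rho + sigma); rewrite (solid_dim piP tN) (solid_dim rP sN).
  have := dim_le5 ((pi + tau) + (rho + sigma)).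
  suff : 4 < \dim ((pi + tau) + (rho + sigma)).
    by rewrite -/U; move: (\dim _) (\dim _) => a b; clear; lia.
  rewrite ltnNge; apply: contra nS => d4.
  rewrite (sub_eq (addvSl (pi + tau) (rho + sigma))) ?(solid_dim piP tN) //.
  by apply: subv_trans (addvSl rho sigma) (addvSr _ _).
have aU : affine Sigma U.
  apply: sub_affine (C_aff CA); rewrite subv_cap.
  by rewrite (subv_trans Ap (addvSl _ _)) (subv_trans Ar (addvSl _ _)).
have dl : \dim (U :&: Sigma) = 2 by have := affine_dim Sigma_hyp aU; rewrite dU => -[].
exists (U :&: Sigma)%VS; rewrite /is_line dl capvSr; split => //.
apply/eqP; rewrite eqEcard card_points2 // card_in_imset.
  rewrite cp leqnn andbT; apply/subsetP => X /imsetP[r]; rewrite inE => /andP[r1 Ar1] ->.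
  have [pu _ uS _ _] := tangent_dir_spec r1 CA Ar1.
  by rewrite inE pu !subv_cap uS !tangent_dir_solid.
move=> r s; rewrite inE [s \in _]inE => /andP[r1 Ar1] /andP[s1 As1].
exact: tangent_dir_inj.
Qed.

Local Open Scope ring_scope.

(** * The conics of the C-planes *)

(** The frame consists of [A], the tangent direction and the axis. *)
Lemma ex_frame pi A : pi \in planes -> A \in C -> (A <= pi)%VS -> exists e0 e1 e2,
  is_frame Sigma pi e0 e1 e2 /\ axis pi = <[e2]>%VS.
Proof.
move=> piP CA Ap.
have [pu up uS us ua] := tangent_dir_spec piP CA Ap; have [pw wp wS] := axisP piP.
have [e0 _ AE] := pointP _ (C_point CA); have [e1 _ uE] := pointP _ pu.
have [e2 _ wE] := pointP _ pw; exists e0, e1, e2; split=> //; split; last exact: plane_dim.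
- by rewrite memvE -AE; apply: C_aff.
- by rewrite memvE -uE.
- by rewrite memvE -wE.
rewrite -AE -uE -wE.
have dpS : \dim (pi :&: Sigma) = 2%N.
  by have := affine_dim Sigma_hyp (plane_aff piP); rewrite (plane_dim piP) => -[].
rewrite (line_join (l := (pi :&: Sigma)%VS) pu pw ua) ?dpS // ?subv_cap ?up ?wp //.
apply/esym/sub_eq; first by rewrite subv_add Ap capvSl.
rewrite dim_addP ?C_point // ?dpS ?plane_dim //.
by apply: contra (C_aff CA); rewrite subv_cap => /andP[].
Qed.

Lemma frame_axis_line e0 e1 e2 x y z pi : is_frame Sigma pi e0 e1 e2 ->
  (<[e0 + x *: e1 + z *: e2]> <= <[e0 + x *: e1 + y *: e2]> + <[e2]>)%VS.
Proof.
move=> fr; rewrite -memvE.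
have -> : e0 + x *: e1 + z *: e2 = e0 + x *: e1 + y *: e2 + (z - y) *: e2.
  by rewrite scalerBl addrACA subrr addr0 addrC addrA.
by rewrite memv_add ?memvZ ?memv_line.
Qed.

(** Each of the q affine lines of [pi] through the axis carries at most one of the q points of the
    arc, hence exactly one. *)
Lemma graph_of_arc pi e0 e1 e2 : pi \in planes -> is_frame Sigma pi e0 e1 e2 -> axis pi = <[e2]>%VS ->
  exists f : F -> F, forall x, <[e0 + x *: e1 + f x *: e2]>%VS \in C.
Proof.
move=> piP fr wE; apply: (@fin_all_exists F (fun=> F)
  (fun x y => <[e0 + x *: e1 + y *: e2]>%VS \in C)) => x.
(* The first coordinate of [P]; the default 0 is never taken on the arc. *)
pose h P : F := odflt 0 [pick x | [exists y, P == <[e0 + x *: e1 + y *: e2]>%VS]].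
have hP P : P \in K pi -> P \in C /\ exists y, P = <[e0 + h P *: e1 + y *: e2]>%VS.
  rewrite inK => /andP[PC Pp]; split=> //.
  have [a [b PE]] := affine_frame_point fr (C_point PC) (C_aff PC) Pp.
  rewrite /h; case: pickP => [c /existsP[d /eqP] ->|/(_ a)/existsP[]] /=; first by exists d.
  by exists b; rewrite PE.
have inj : {in K pi &, injective h}.
  move=> P R PK RK eqh; have [PC [y PE]] := hP P PK; have [RC [z RE]] := hP R RK.
  rewrite -eqh in RE; apply: (axis_line piP RC _ PC).
    by move: RK; rewrite inK => /andP[].
  by rewrite {1}PE RE wE; apply: frame_axis_line fr.
have : x \in h @: K pi.
  suff -> : h @: K pi = setT by rewrite inE.
  by apply/eqP; rewrite eqEcard subsetT cardsT card_in_imset // cardK // leqnn.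
by move=> /imsetP[P PK ->]; have [PC [y PE]] := hP P PK; exists y; rewrite -PE.
Qed.

Lemma graph_noncollinear pi e0 e1 e2 f : pi \in planes -> is_frame Sigma pi e0 e1 e2 ->
  (forall x, <[e0 + x *: e1 + f x *: e2]>%VS \in C) ->
  forall a b c, a != b -> a != c -> b != c ->
  (f b - f a) * (c - a) != (f c - f a) * (b - a).
Proof.
move=> piP fr fC a b c ab ac bc; apply/negP => /eqP col.
pose v x := e0 + x *: e1 + f x *: e2.
have vK x : <[v x]>%VS \in K pi by rewrite inK fC (frame_point_sub _ _ fr).
have vinj x y : x != y -> <[v x]>%VS != <[v y]>%VS :> PG4 F.
  by apply: contra_neq => eqv; have [] := frame_point_inj fr eqv.
have dl : \dim (<[v a]> + <[v b]>) = 2%N.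
  by apply: dim_join; rewrite ?vinj // C_point // fC.
apply: (no_three piP (vK a) (vK b) (vK c) (vinj a b ab) (vinj a c ac) (vinj b c bc) dl).
- exact: addvSl.
- exact: addvSr.
have ba0 : b - a != 0 by rewrite subr_eq0 eq_sym.
pose m := (c - a) / (b - a).
have mE : m * (b - a) = c - a by rewrite divfK.
have mf : m * (f b - f a) = f c - f a.
  by apply: (mulIf ba0); rewrite -col mulrAC mE mulrC.
have -> : v c = (1 - m) *: v a + m *: v b.
  rewrite /v !scalerDr !scalerA addrACA [_ *: e0 + _ + _]addrACA -!scalerDl.
  congr (_ + _ *: _ + _ *: _); first by rewrite subrK scale1r.
    by rewrite -[c](subrK a) -mE; ring.
  by rewrite -[f c](subrK (f a)) -mf; ring.
by rewrite -memvE memv_add ?memvZ ?memv_line.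
Qed.

(** Segre's theorem makes the graph quadratic, with nonzero leading coefficient since otherwise the
    arc would lie on a line; a change of frame normalises it. *)
Lemma arc_parabola pi : pi \in planes -> exists e0 e1 e2,
  [/\ is_frame Sigma pi e0 e1 e2, axis pi = <[e2]>%VS
    & K pi = [set parabola_point e0 e1 e2 x | x : F]].
Proof.
move=> piP; have [A CA Ap] := ex_C piP.
have [e0 [e1 [e2 [fr wE]]]] := ex_frame piP CA Ap.
have [f fC] := graph_of_arc piP fr wE.
have arc := graph_noncollinear piP fr fC.
have [r [s [t fE]]] := segre_parabola q_odd arc.
have t0 : t != 0.
  have /card_gt2P[a [b [c [_ [ab bc ca]]]]] : (2 < #|[set: F]|)%N by rewrite cardsT (leq_trans _ q_ge7).
  have := arc a b c ab _ bc; rewrite eq_sym ca => /(_ isT).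
  by apply: contraNneq => tz; rewrite !fE tz; apply/eqP; ring.
have fr' := frame_change r s t0 fr.
exists (e0 + r *: e2), (e1 + s *: e2), (t *: e2); split => //.
  have [_ _ e2n] := frame_neq0 fr; have [_ _ te2n] := frame_neq0 fr'.
  rewrite wE; apply/esym/point_sub_eq; rewrite ?line_point //.
  by rewrite -memvE memvZ ?memv_line.
have pE x : parabola_point (e0 + r *: e2) (e1 + s *: e2) (t *: e2) x =
    <[e0 + x *: e1 + f x *: e2]>%VS.
  congr (<[_]>%VS); rewrite fE !scalerDr !scalerDl !scalerA.
  rewrite addrACA -!addrA; congr (_ + (_ + _)).
  by rewrite [x * s]mulrC [x ^+ 2 * t]mulrC addrA.
apply/esym/eqP; rewrite eqEcard card_imset; last first.
  by move=> x y; rewrite !pE => /(frame_point_inj fr)[].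
rewrite cardK // leqnn andbT; apply/subsetP => P /imsetP[x _ ->].
by rewrite pE inK fC (frame_point_sub _ _ fr).
Qed.

Lemma axis_conic pi : pi \in planes -> is_conic pi (axis pi |: K pi).
Proof.
move=> piP; have [e0 [e1 [e2 [fr -> ->]]]] := arc_parabola piP.
exact: parabola_conic (two_neq0 q_odd) fr.
Qed.

Lemma axis_notC pi : pi \in planes -> axis pi \notin C.
Proof. by move=> piP; have [_ _ wS] := axisP piP; apply: contraL wS => /C_aff. Qed.

(** A quadratic form that vanishes on the arc also vanishes at the axis. So the axis is on the
    conic, and as it is not in [C], it is the added point. *)
Lemma conic_completion pi X : pi \in planes -> is_conic pi (X |: K pi) -> X = axis pi.
Proof.
move=> piP /andP[_ /existsP[Q /andP[_ /eqP XE]]].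
have [e0 [e1 [e2 [fr wE KE]]]] := arc_parabola piP; have [pw wp _] := axisP piP.
have : axis pi \in quadric_points pi Q.
  rewrite inE [_ \in points_on _]inE pw wp /= wE.
  apply/forallP => v; apply/implyP => /vlineP[k ->].
  rewrite qformZ (@qform_parabola_infinity _ e0 e1) ?mulr0 ?(leq_trans _ q_ge7) // => x.
  have : parabola_point e0 e1 e2 x \in quadric_points pi Q.
    by rewrite -XE KE in_setU1 imset_f ?orbT.
  by rewrite inE => /andP[_ /forallP/(_ (e0 + x *: e1 + x ^+ 2 *: e2))]; rewrite memv_line => /eqP.
rewrite -XE in_setU1 inK (negPf (axis_notC piP)) orbF => /eqP -> //.
Qed.

Lemma tangent_line pi A : pi \in planes -> A \in C -> (A <= pi)%VS ->
  [/\ \dim (A + tangent_dir pi A) = 2%N, affine Sigma (A + tangent_dir pi A)%VS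
    & ((A + tangent_dir pi A) :&: Sigma)%VS = tangent_dir pi A].
Proof.
move=> piP CA Ap; have [pu _ uS _ _] := tangent_dir_spec piP CA Ap.
have Au : A != tangent_dir pi A by apply: contraNneq (C_aff CA) => {1}->.
have dl := dim_join (C_point CA) pu Au.
have al := sub_affine (addvSl A (tangent_dir pi A)) (C_aff CA).
by split=> //; apply/esym/point_sub_eq; rewrite ?affine_line_dir // subv_cap addvSr.
Qed.

(** A line of [pi] through [A] has no other point on the conic exactly when its point at infinity is
    neither the axis nor on a secant. *)
Lemma tangent_at pi A l : pi \in planes -> A \in C -> (A <= pi)%VS ->
  is_tangent pi (axis pi |: K pi) A l = (l == A + tangent_dir pi A)%VS.
Proof.
move=> piP CA Ap; have [pu up uS us ua] := tangent_dir_spec piP CA Ap.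
have [pw wp wS] := axisP piP.
have AK : A \in axis pi |: K pi by rewrite in_setU1 inK CA Ap orbT.
apply/idP/eqP => [/and3P[/eqP dl lp /eqP cap]|->].
  have Al : (A <= l)%VS.
    have : A \in points_on l :&: (axis pi |: K pi) by rewrite cap set11.
    by rewrite in_setI inE => /andP[/andP[]].
  have al := sub_affine Al (C_aff CA).
  suff <- : (l :&: Sigma)%VS = tangent_dir pi A.
    by rewrite (affine_line_join (C_point CA) (C_aff CA) Al dl).
  have pd := affine_line_dir dl al.
  apply/eqP; rewrite -tangent_dirP // in_setD1 in_setD inE pd capvS // !andbT /=.
  have only X : is_point X -> (X <= l)%VS -> X \in axis pi |: K pi -> X = A.
    move=> pX Xl XK; apply/set1P; rewrite -cap in_setI XK inE pX Xl //.
  apply/andP; split.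
    apply/eqP => dw; move/negP: (C_aff CA); apply.
    rewrite -(only (axis pi)) ?setU11 //; by rewrite -dw capvSl.
  apply/imsetP => -[B]; rewrite in_setD1 inK => /and3P[BA BC Bp] eqd.
  have AB : A != B by rewrite eq_sym.
  have [d1 a1 _] := join_CC CA BC AB.
  have eql := affine_line_eq (C_point CA) (C_aff CA) Al (addvSl A B) dl d1 eqd.
  move/negP: BA; apply; apply/eqP/only; rewrite ?C_point //.
    by rewrite eql addvSr.
  by rewrite in_setU1 inK BC Bp orbT.
have [dl _ lS] := tangent_line piP CA Ap; apply/and3P; split; first exact/eqP.
  by rewrite subv_add Ap.
apply/eqP/setP => X; rewrite in_setI in_set1 inE.
apply/idP/eqP => [/andP[/andP[pX Xl]]|->]; last by rewrite C_point // addvSl.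
rewrite in_setU1 inK => /orP[/eqP Xw|/andP[XC Xp]].
  move/negP: ua; case; apply/eqP/esym/point_sub_eq => //.
  by rewrite -lS subv_cap wS -Xw Xl.
apply/eqP/negPn/negP => XA; move/negP: us; apply; apply/imsetP; exists X.
  by rewrite in_setD1 XA inK XC.
rewrite -[LHS]lS (line_join (l := (A + tangent_dir pi A)%VS)) ?C_point ?dl ?addvSl //.
by rewrite eq_sym.
Qed.

Lemma tangent_trace pi A P : pi \in planes -> A \in C -> (A <= pi)%VS ->
  is_tangent_trace Sigma C A pi P = (P == tangent_dir pi A).
Proof.
move=> piP CA Ap; have [_ _ lS] := tangent_line piP CA Ap.
apply/existsP/eqP => [[X /existsP[l /and3P[Xc lt /eqP ->]]]|->].
  rewrite (conic_completion piP Xc) tangent_at // in lt.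
  by rewrite (eqP lt).
exists (axis pi); apply/existsP; exists (A + tangent_dir pi A)%VS.
by rewrite axis_conic // tangent_at // lS !eqxx.
Qed.

Lemma t_set_line A : A \in C -> exists l : PG4 F,
  [/\ is_line l, (l <= Sigma)%VS & t_set Sigma C planes A = points_on l].
Proof.
move=> CA; have [l [ll lS lE]] := tangent_dirs_line CA; exists l; split => //; rewrite -lE.
apply/setP => P; rewrite inE; apply/existsP/imsetP => [[pi /and3P[piP Ap]]|[pi]].
  by rewrite tangent_trace // => /eqP ->; exists pi; rewrite // inE piP.
by rewrite inE => /andP[piP Ap] ->; exists pi; rewrite piP Ap tangent_trace // eqxx.
Qed.

End CPlanes.

Theorem theorem3p14 (F : finFieldType) (q : nat) (card_F : #|F| = q)
  (q_odd : odd q) (q_ge7 : 7 <= q)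
  (Sigma : PG4 F) (Sigma_hyp : is_hyperplane Sigma)
  (C planes : {set PG4 F})
  (C_affine : forall P : PG4 F, P \in C -> is_point P && affine Sigma P)
  (card_C : #|C| = q ^ 2)
  (planes_affine : forall pi : PG4 F, pi \in planes -> is_plane pi && affine Sigma pi)
  (A1_arc : forall pi : PG4 F, pi \in planes -> is_arc q pi (points_on pi :&: C))
  (A1_plane : forall pi : PG4 F,
     is_plane pi -> 4 < #|points_on pi :&: C| -> pi \in planes)
  (A2 : forall P R : PG4 F, P \in C -> R \in C -> P <> R ->
     exists! pi : PG4 F, [/\ pi \in planes, (P <= pi)%VS & (R <= pi)%VS])
  (A3 : forall P : PG4 F, is_point P -> affine Sigma P ->
     [\/ P \in C,
         forall pi : PG4 F, pi \in planes -> ~~ (P <= pi)%VS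
       | #|[set pi in planes | (P <= pi)%VS]| = 2]) :
  forall A : PG4 F, A \in C ->
    exists l : PG4 F,
      [/\ is_line l, (l <= Sigma)%VS & t_set Sigma C planes A = points_on l].
Proof.
move=> A CA; subst q.
apply: (t_set_line q_odd q_ge7 Sigma_hyp C_affine card_C planes_affine A1_arc A1_plane A2 A3).
exact: CA.
Qed.
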